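(* Let $d\ge2$, $k\ge1$, let $K\in\mathcal K_h$ and let $\Sigma_h^{-1}(K)=\{\boldsymbol\tau\in L^2(K;\mathbb S):\boldsymbol\tau|_T\in\mathbb P_k(T;\mathbb S)\ \forall T\in\mathcal T_h(K)\}$. Then $\Sigma_h^{-1}(K)$ is uniquely determined by (i.e. unisolvent for) the following degrees of freedom of $\boldsymbol\sigma\in\Sigma_h^{-1}(K)$: 1. $\displaystyle\int_F\boldsymbol\sigma\boldsymbol n\cdot\boldsymbol q\,ds$ for $\boldsymbol q\in\mathbb P_k(F;\mathbb R^d)$ and every face $F$ of $K$; 2. $\displaystyle\int_K\boldsymbol\sigma:\boldsymbol\tau\,dx$ for $\boldsymbol\tau$ in the $L^2(K;\mathbb S)$-orthogonal complement, within $\mathbb B_k(\operatorname{div},K;\mathbb S)$, of $\bigoplus_{\ell=1}^{d(d+1)/2}\chi_{T_\ell}\mathbb P_k(T_\ell)\,b_\ell$; 3. $\displaystyle\int_K\boldsymbol\sigma:\boldsymbol\tau\,dx$ for $\boldsymbol\tau\in\mathbb P_k(K;\mathbb S)$. That is, the number of degrees of freedom (counted by bases of the test spaces) equals $\dim\Sigma_h^{-1}(K)$, and $\boldsymbol\sigma=\boldsymbol0$ whenever all of them vanish.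
   Context: $\mathbb S$ is the space of symmetric $d\times d$ real matrices; $\mathbb P_k(D;X)$ denotes $X$-valued polynomials of degree at most $k$ on $D$; $\chi_T$ is the characteristic function of $T$; $\boldsymbol\sigma:\boldsymbol\tau$ is the Frobenius product; $\boldsymbol n$ is the unit outward normal on $\partial K$. $\mathcal K_h$ is a polytopal mesh whose elements $K$ are star-shaped polytopes. $\boldsymbol x_K$ is the center of the largest ball inside $K$; connecting $\boldsymbol x_K$ to the vertices of $K$ splits $K$ (with faces $F_1,\dots,F_n$) into pyramids $T_i$ with base $F_i$ and apex $\boldsymbol x_K$, and $\mathcal T_h(K)=\{T_1,\dots,T_n\}$ is the resulting non-degenerate partition of $K$. Bubble space: $\mathbb B_k(\operatorname{div},K;\mathbb S)=\{\boldsymbol\tau\in\Sigma_h^{-1}(K):\boldsymbol\tau\boldsymbol n|_{\partial K}=\boldsymbol0\}$. For a face $F$, $\mathscr T^F$ is the space of vectors tangential to $F$ and $\mathscr T^F(\mathbb S)=\operatorname{span}\{\operatorname{sym}(\boldsymbol s\otimes\boldsymbol t):\boldsymbol s,\boldsymbol t\in\mathscr T^F\}$. Standing assumption on $K$: there are bases $\{b_i^m\}_{m=1}^{d(d-1)/2}$ of $\mathscr T^{F_i}(\mathbb S)$, $i=1,\dots,n$, and tensors $b_1,\dots,b_{d(d+1)/2}$ chosen among the $b_i^m$ with $\mathbb S=\operatorname{span}\{b_\ell:\ell=1,\dots,d(d+1)/2\}$. For each $\ell$, $T_\ell\in\mathcal T_h(K)$ (in the degrees of freedom above) denotes a fixed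 pyramid whose base $F$ is a face of $K$ from which $b_\ell$ was chosen, so that $b_\ell\in\mathscr T^{F}(\mathbb S)$. *)

(* Defs.v *)
From HB Require Import structures.
From mathcomp Require Import all_boot all_order all_algebra.
From mathcomp.multinomials Require Import -(notations) mpoly.
From mathcomp Require Import all_classical all_reals all_analysis.
Set Implicit Arguments.
Unset Strict Implicit.
Unset Printing Implicit Defensive.
Import Order.TTheory GRing.Theory Num.Theory.
Import numFieldNormedType.Exports.
Local Open Scope classical_set_scope.
Local Open Scope ring_scope.

Section Lebesgue.
Context {R : realType}.

Definition cons_pair m (p : m.-tuple (measurableTypeR R) * measurableTypeR R) :
  m.+1.-tuple (measurableTypeR R) := [tuple of p.2 :: p.1].

Lemma measurable_cons_pair m : measurable_fun [set: _] (@cons_pair m).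
Proof. exact: (measurable_cons (f := snd) (g := fst)). Qed.

Definition lebesgue_cons m
    (mu : {measure set (m.-tuple (measurableTypeR R)) -> \bar R}) :
    {measure set (m.+1.-tuple (measurableTypeR R)) -> \bar R} :=
  measure_function_pushforward__canonical__measure_function_Measure
    (mu \x lebesgue_measure)%E (@measurable_cons_pair m).

(** The m-fold product of the Lebesgue measure of R; on R^0 it is the unit
    mass. *)
Fixpoint lebesgue_tuple (m : nat) :
    {measure set (m.-tuple (measurableTypeR R)) -> \bar R} :=
  match m with
  | 0 => \d_([tuple] : 0.-tuple (measurableTypeR R))
  | m'.+1 => lebesgue_cons (lebesgue_tuple m')
  end.

(** Points of R^m are column vectors; sets and functions are pulled back to
    tuples, which carry the product sigma-algebra. *)
Definition tcol m (t : m.-tuple (measurableTypeR R)) : 'cV[R]_m :=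
  \col_i tnth t i.

Definition integral_on m (A : set 'cV[R]_m) (f : 'cV[R]_m -> R) : R :=
  \int[lebesgue_tuple m]_(t in @tcol m @^-1` A) f (tcol t).

Definition ae_on m (A : set 'cV[R]_m) (P : 'cV[R]_m -> Prop) : Prop :=
  {ae lebesgue_tuple m, forall t, A (tcol t) -> P (tcol t)}.

Definition square_integrable_on m (A : set 'cV[R]_m) (f : 'cV[R]_m -> R) :=
  measurable_fun (@tcol m @^-1` A) (f \o @tcol m) /\
  (\int[lebesgue_tuple m]_(t in @tcol m @^-1` A) ((f (tcol t)) ^+ 2)%:E
     < +oo)%E.

End Lebesgue.

Section LinearAlgebra.
Context {R : realType}.

Definition linspan (E : lmodType R) (A : set E) : set E :=
  [set x | exists (m : nat) (v : 'I_m -> E) (c : 'I_m -> R),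
     (forall i, A (v i)) /\ x = \sum_i c i *: v i].

(** [e] is a basis of the image of the subspace [V] in the quotient of [E] by
    the subspace [Z]; [Z] is the set of elements identified with 0 (functions
    vanishing on the domain, or almost everywhere on it). *)
Definition basis_mod (E : lmodType R) (Z V : set E) m (e : 'I_m -> E) :=
  [/\ forall i, V (e i),
      forall c : 'I_m -> R, Z (\sum_i c i *: e i) -> forall i, c i = 0 &
      forall x, V x -> exists c : 'I_m -> R, Z (x - \sum_i c i *: e i)].

Definition has_dim_mod (E : lmodType R) (Z V : set E) (m : nat) :=
  exists e : 'I_m -> E, basis_mod Z V e.

Definition dotv d (x y : 'cV[R]_d) : R := \sum_i x i 0 * y i 0.

Definition frob d (A B : 'M[R]_d) : R := \sum_i \sum_j A i j * B i j.

Definition symmx d : set 'M[R]_d := [set A | A^T = A].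

Definition sym_tensor d (s t : 'cV[R]_d) : 'M[R]_d :=
  2^-1 *: (s *m t^T + t *m s^T).

(** The matrix norm of the library is the sup norm, hence this Euclidean
    ball. *)
Definition eball d (x : 'cV[R]_d) (r : R) : set 'cV[R]_d :=
  [set y | dotv (y - x) (y - x) <= r ^+ 2].

End LinearAlgebra.

Section Geometry.
Context {R : realType}.

Definition conv_hull m (s : seq 'cV[R]_m) : set 'cV[R]_m :=
  [set x | exists w : 'I_(size s) -> R,
     [/\ forall i, 0 <= w i, \sum_i w i = 1 & x = \sum_i w i *: s`_i]].

(** Full-dimensional, not necessarily convex. *)
Definition polytope m (P : set 'cV[R]_m) : Prop :=
  [/\ exists ss : seq (seq 'cV[R]_m),
        P = [set x | exists2 s, s \in ss & conv_hull s x],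
      regclosed P & P !=set0].

(** A (d-1)-dimensional polytope in an affine hyperplane of R^d, described in
    the isometric coordinates [u |-> face_origin + face_frame *m u]. *)
Record flat_face (d : nat) := FlatFace {
  face_origin : 'cV[R]_d ;
  face_frame : 'M[R]_(d, d.-1) ;
  face_normal : 'cV[R]_d ;
  face_param : set 'cV[R]_d.-1 ;
  face_frame_orthonormal : face_frame^T *m face_frame = 1%:M ;
  face_normal_unit : dotv face_normal face_normal = 1 ;
  face_normal_orth : face_frame^T *m face_normal = 0 ;
  face_param_polytope : polytope face_param
}.

Definition face_chart d (F : flat_face d) (u : 'cV[R]_d.-1) : 'cV[R]_d :=
  face_origin F + face_frame F *m u.

Definition face_set d (F : flat_face d) : set 'cV[R]_d :=
  face_chart F @` face_param F.

(** As [face_chart] is an isometry, this is integration against the surface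
    measure. *)
Definition face_integral d (F : flat_face d) (f : 'cV[R]_d -> R) : R :=
  integral_on (face_param F) (f \o face_chart F).

Definition outward_normal d (A : set 'cV[R]_d) (F : flat_face d) : Prop :=
  forall u, (face_param F)° u ->
    exists2 e : R, 0 < e &
      forall t, 0 < t < e -> ~ A (face_chart F u + t *: face_normal F).

Definition cone d (c : 'cV[R]_d) (A : set 'cV[R]_d) : set 'cV[R]_d :=
  [set x | exists (t : R) (y : 'cV[R]_d),
     [/\ 0 <= t <= 1, A y & x = (1 - t) *: c + t *: y]].

Definition nondegenerate_partition d n (A : set 'cV[R]_d)
    (T : 'I_n -> set 'cV[R]_d) : Prop :=
  [/\ A = \bigcup_i T i,
      forall i, (T i)° !=set0 &
      forall i j, i != j -> (T i)° `&` (T j)° = set0].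

Record star_polytope (d : nat) := StarPolytope {
  carrier : set 'cV[R]_d ;
  nfaces : nat ;
  face : 'I_nfaces -> flat_face d ;
  center : 'cV[R]_d ;
  carrier_polytope : polytope carrier ;
  carrier_boundary : carrier `\` carrier° = \bigcup_i face_set (face i) ;
  carrier_outward : forall i, outward_normal carrier (face i) ;
  center_star_shaped : cone center carrier `<=` carrier ;
  center_largest_ball : exists r : R,
    [/\ 0 < r, eball center r `<=` carrier &
        forall y s, 0 <= s -> eball y s `<=` carrier -> s <= r] ;
  center_pyramids :
    nondegenerate_partition carrier (fun i => cone center (face_set (face i)))
}.

Definition pyramid d (K : star_polytope d) (i : 'I_(nfaces K)) : set 'cV[R]_d :=
  cone (center K) (face_set (face i)).

Definition tangent d (F : flat_face d) : set 'cV[R]_d :=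
  [set s | dotv s (face_normal F) = 0].

Definition tangent_sym d (F : flat_face d) : set 'M[R]_d :=
  linspan [set A | exists s t, [/\ tangent F s, tangent F t & A = sym_tensor s t]].

(** [frame_basis i] is a basis of the symmetric tangential tensors of the i-th
    face; [frame_face] and [frame_index] select among all these basis tensors a
    spanning family of the symmetric matrices and record, for each selected
    tensor, the face it was taken from. *)
Record tangential_frame d (K : star_polytope d) := TangentialFrame {
  frame_basis : 'I_(nfaces K) -> 'I_((d * d.-1)./2) -> 'M[R]_d ;
  frame_basisP : forall i,
    basis_mod [set 0] (tangent_sym (face i)) (frame_basis i) ;
  frame_face : 'I_((d * d.+1)./2) -> 'I_(nfaces K) ;
  frame_index : 'I_((d * d.+1)./2) -> 'I_((d * d.-1)./2) ;
  frame_span :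
    symmx (d := d) =
    linspan (range (fun l => frame_basis (frame_face l) (frame_index l)))
}.

Definition frame_tensor d (K : star_polytope d) (b : tangential_frame K) l :=
  frame_basis b (frame_face b l) (frame_index b l).

End Geometry.

Arguments flat_face R d : clear implicits.
Arguments star_polytope R d : clear implicits.

Section Spaces.
Context {R : realType}.

(** Polynomials of degree at most k; [msize] is the degree plus one. *)
Definition poly_fun d k (f : 'cV[R]_d -> R) : Prop :=
  exists2 p : mpoly d R, (mpoly.msize p <= k.+1)%N &
    f = fun x => meval (fun i => x i 0) p.

Definition poly_vec d k : set ('cV[R]_d -> 'cV[R]_d) :=
  [set q : 'cV[R]_d -> 'cV[R]_d | forall i, poly_fun k (fun x => q x i 0)].

Definition poly_sym d k : set ('cV[R]_d -> 'M[R]_d) :=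
  [set s : 'cV[R]_d -> 'M[R]_d | (forall i j, poly_fun k (fun x => s x i j)) /\
           forall x, symmx (s x)].

Definition vanish_on d (E : zmodType) (A : set 'cV[R]_d) : set ('cV[R]_d -> E) :=
  [set f | forall x, A x -> f x = 0].

Definition ae_vanish_on d (E : zmodType) (A : set 'cV[R]_d) :
    set ('cV[R]_d -> E) :=
  [set f | ae_on A (fun x => f x = 0)].

Definition L2_sym d (A : set 'cV[R]_d) : set ('cV[R]_d -> 'M[R]_d) :=
  [set s : 'cV[R]_d -> 'M[R]_d | (forall i j, square_integrable_on A (fun x => s x i j)) /\
           ae_on A (fun x => symmx (s x))].

Context (d k : nat) (K : star_polytope R d).
Implicit Types (i : 'I_(nfaces K)) (s : 'cV[R]_d -> 'M[R]_d).

(** Elements are representatives of L^2 classes, so that all equalities on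
    d-dimensional sets are almost everywhere; the pyramids are closed and share
    their lateral faces. *)
Definition Sigma_space : set ('cV[R]_d -> 'M[R]_d) :=
  [set s | L2_sym (carrier K) s /\
     forall i, exists2 p, poly_sym k p & ae_on (pyramid i) (fun x => s x = p x)].

(** The polynomial (unique, since the pyramid is nondegenerate) which [s]
    coincides with on the i-th pyramid; it gives the trace of [s] on the i-th
    face. *)
Definition local_poly i s : 'cV[R]_d -> 'M[R]_d :=
  xget (fun=> 0)
    [set p | poly_sym k p /\ ae_on (pyramid i) (fun x => s x = p x)].

Definition normal_trace i s : 'cV[R]_d -> 'cV[R]_d :=
  fun x => local_poly i s x *m face_normal (face i).

Definition bubble_space : set ('cV[R]_d -> 'M[R]_d) :=
  [set s | Sigma_space s /\
     forall i, vanish_on (face_set (face i)) (normal_trace i s)].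

Definition face_dof i (q : 'cV[R]_d -> 'cV[R]_d) s : R :=
  face_integral (face i) (fun x => dotv (normal_trace i s x) (q x)).

Definition volume_dof (t s : 'cV[R]_d -> 'M[R]_d) : R :=
  integral_on (carrier K) (fun x => frob (s x) (t x)).

Definition frame_space (b : tangential_frame K) : set ('cV[R]_d -> 'M[R]_d) :=
  [set s | exists p : 'I_((d * d.+1)./2) -> 'cV[R]_d -> R,
     (forall l, poly_fun k (p l)) /\
     s = fun x => \sum_l
           (\1_(pyramid (frame_face b l)) x * p l x) *: frame_tensor b l].

Definition bubble_complement (b : tangential_frame K) :
    set ('cV[R]_d -> 'M[R]_d) :=
  [set t | bubble_space t /\ forall r, frame_space b r -> volume_dof r t = 0].

End Spaces.

(* Main.v *)
(** The normal trace maps [Sigma] onto the product of the polynomial spaces of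
    the faces, because [v] is the normal component of the symmetric matrix
    [v n^T + n v^T - (v . n) n n^T]; its kernel is the bubble space. Inside the
    bubble space, [p |-> \sum_l chi_(T_l) (p : bd_l) b_l], with [bd] the Frobenius
    dual basis of the frame [b], is a linear bijection, modulo null sets, from
    the symmetric polynomials onto the frame space, and the bubble space is the
    orthogonal sum of the frame space and its complement. This gives the
    dimension count. If all degrees of freedom of [s] vanish, the first family
    puts [s] in the bubble space, the second one kills its component in the
    complement, so that [s = \sum_l chi_(T_l) p_l b_l], and testing against
    [\sum_l p_l bd_l] yields [\sum_l \int_(T_l) p_l^2 = 0].

    Two facts of measure theory are needed: the zero set of a nonzero polynomial
    is null (Fubini), and the pyramids overlap in null sets, since a convex set
    with empty interior lies in a hyperplane. *)
Require Import Defs.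
From mathcomp Require Import all_boot all_order all_algebra.
From mathcomp.multinomials Require Import -(notations) mpoly.
From mathcomp Require Import all_classical all_reals all_analysis measurable_realfun.
From mathcomp Require Import ring.
Set Implicit Arguments.
Unset Strict Implicit.
Unset Printing Implicit Defensive.
Import Order.TTheory GRing.Theory Num.Theory.
Import numFieldNormedType.Exports.
Local Open Scope classical_set_scope.
Local Open Scope ring_scope.

(** * Lebesgue measure on tuples *)

Section TupleLebesgue.
Context {R : realType}.
Notation mR := (measurableTypeR R).
Notation lam := (@lebesgue_measure R).

(** Traces are the delicate point: faces are null sets, while an element of the broken space is
    known only almost everywhere. A polynomial that vanishes almost everywhere on a set with
    interior vanishes identically, so each pyramid determines one polynomial, whose restriction to
    the base face is the trace. No continuity is imposed across lateral faces of pyramids; hence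
    cutting [b_l] off to a pyramid gives a bubble as soon as [b_l] annihilates the normal of the
    base. The same rigidity explains why cutting each coefficient [p : bd_l] off to its own pyramid
    loses nothing: the pyramid has interior, so the coefficient is recovered on all of K. This is
    why the frame space has the dimension of the symmetric polynomials and why the third family
    detects it. Since faces, and therefore pyramids, may be nonconvex, the null overlap has to be
    proved piece by piece on convex hulls. Dimensions are taken modulo null functions without
    forming quotients: maximal independent families are chosen relative to a subspace [Z]. *)

Lemma lebesgue_tuple_xsection m (A : set (m.+1.-tuple mR)) : measurable A ->
  lebesgue_tuple m.+1 A =
  (\int[lebesgue_tuple m]_t lam [set y : R | A [tuple of (y : mR) :: t]])%E.
Proof.
move=> mA; rewrite [LHS]/= /pushforward /product_measure1.
apply: eq_integral => t _ /=; congr (lam _).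
by rewrite /xsection; apply/seteqP; split=> y; rewrite /= inE.
Qed.

(** Cubes are the yardstick: their positive volume shows that sets with interior are not null, their
    finite volume that bounded measurable sets have finite measure. Measurability is carried along
    because the induction integrates the indicator of the lower cube. *)
Lemma lebesgue_tuple_cube m (c : m.-tuple mR) (e : R) : 0 < e ->
  measurable [set t : m.-tuple mR | forall i, `|tnth t i - tnth c i| < e] /\
  lebesgue_tuple m [set t | forall i, `|tnth t i - tnth c i| < e] =
  ((e *+ 2) ^+ m)%:E.
Proof.
move=> e0; elim: m c => [|m IH] c.
  have -> : [set t : 0.-tuple mR | forall i, `|tnth t i - tnth c i| < e] = setT.
    by apply/seteqP; split=> // t _ [].
  by split=> //=; rewrite diracE in_setT.
have meas : measurable
    [set t : m.+1.-tuple mR | forall i, `|tnth t i - tnth c i| < e].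
  rewrite (_ : mkset _ = \bigcap_(i in [set: 'I_m.+1])
      ((fun t => tnth t i) @^-1` [set x : mR | `|x - tnth c i| < e])).
    apply: fin_bigcap_measurable => [|i _]; first exact: finite_finset.
    rewrite -[X in measurable X]setTI; apply: measurable_tnth => //.
    rewrite (_ : mkset _ = `]tnth c i - e, tnth c i + e[%classic).
      exact: measurable_itv.
    by apply/seteqP; split=> x /=; rewrite ltr_distl in_itv/=.
  by apply/seteqP; split=> t /= h i; [move=> _|]; apply: h.
split=> //; rewrite lebesgue_tuple_xsection//.
pose c' := [tuple of behead c].
have [mB muB] := IH c'; set B := (X in measurable X) in mB muB.
(* Over the lower cube [B] the slice is an interval of length 2e; elsewhere it is empty. *)
rewrite (eq_integral (fun t => (e *+ 2)%:E * (\1_B t)%:E)%E); last first.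
  move=> t _.
  have [tB|tB] := pselect (B t).
    rewrite indicE mem_set// mule1.
    rewrite (_ : mkset _ = `]thead c - e, thead c + e[%classic); last first.
      apply/seteqP; split=> y /=.
        by move/(_ ord0); rewrite (tnth_nth 0)/= in_itv /= ltr_distl.
      rewrite in_itv /= -ltr_distl => h i.
      case: (unliftP ord0 i) => [j ->|->]; last by rewrite (tnth_nth 0)/=.
      rewrite tnthS; have := tB j.
      rewrite /c' tnth_behead (_ : inord _ = lift ord0 j)//.
      by apply/val_inj; rewrite /= inordK// ltnS.
    rewrite lebesgue_measure_itv/= lte_fin ifT; last by rewrite ltrBlDr -addrA ltrDl addr_gt0.
    by rewrite -EFinD; congr EFin; rewrite opprD opprK addrACA subrr add0r mulr2n.
  rewrite indicE memNset// mule0 (_ : mkset _ = set0) ?measure0//.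
  apply/seteqP; split=> // y /= h; apply: tB => j; have := h (lift ord0 j).
  rewrite tnthS /c' tnth_behead (_ : inord _ = lift ord0 j)//.
  by apply/val_inj; rewrite /= inordK// ltnS.
rewrite ge0_integralZl//; first
  by rewrite integral_indic// setIT [X in (_ * X)%E]muB -EFinM exprS.
- by apply/measurable_EFinP; exact: measurable_indic.
- by rewrite lee_fin mulrn_wge0// ltW.
Qed.

(** Polynomials in the first coordinate whose coefficients are again of this kind in the others. The
    recursion is that of [lebesgue_tuple], so a Fubini slice is a univariate polynomial. On the
    one-point space of dimension 0 every function qualifies. *)
Fixpoint ipoly m : (m.-tuple mR -> R) -> Prop :=
  match m with
  | 0 => fun=> True
  | m'.+1 => fun f => exists n (c : nat -> m'.-tuple mR -> R),
      (forall j, ipoly (c j)) /\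
      forall (y : R) (t : m'.-tuple mR),
        f [tuple of (y : mR) :: t] = \sum_(j < n) c j t * y ^+ j
  end.

Lemma ipoly0 m : ipoly ((fun=> 0) : m.-tuple mR -> R).
Proof.
case: m => //= m; exists 0, (fun _ _ => 0); split=> [j|y t].
  by elim: m => //= m IH; exists 0, (fun _ _ => 0); split=> // y t; rewrite big_ord0.
by rewrite big_ord0.
Qed.

Lemma ipolyD m (f g : m.-tuple mR -> R) :
  ipoly f -> ipoly g -> ipoly (fun t => f t + g t).
Proof.
elim: m f g => //= m IH f g [n [c [pc fE]]] [n' [c' [pc' gE]]].
exists (maxn n n'), (fun j t => (if (j < n)%N then c j t else 0) +
                               (if (j < n')%N then c' j t else 0)).
split=> [j|y t].
  by apply: IH; [case: (j < n)%N | case: (j < n')%N] => //; exact: ipoly0.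
rewrite fE gE; under [RHS]eq_bigr do rewrite mulrDl.
rewrite big_split; congr (_ + _).
  rewrite (big_ord_widen (maxn n n') (fun j => c j t * y ^+ j)) ?leq_maxl//.
  by rewrite big_mkcond; apply: eq_bigr => j _; case: ifP => // _; rewrite mul0r.
rewrite (big_ord_widen (maxn n n') (fun j => c' j t * y ^+ j)) ?leq_maxr//.
by rewrite big_mkcond; apply: eq_bigr => j _; case: ifP => // _; rewrite mul0r.
Qed.

Lemma ipoly_monomial m (a : R) (e : 'I_m -> nat) :
  ipoly (fun t : m.-tuple mR => a * \prod_i (tnth t i : R) ^+ e i).
Proof.
elim: m e => //= m IH e.
(* The first variable occurs with the single power [e ord0]: one more coefficient than that is
   listed, and all but the last are zero. *)
exists (e ord0).+1, (fun j t => if j == e ord0 then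
  a * \prod_i (tnth t i : R) ^+ e (lift ord0 i) else 0); split=> [j|y t].
  by case: (j == e ord0); [exact: IH | exact: ipoly0].
rewrite [RHS]big_ord_recr/= eqxx [X in _ = X + _]big1 ?add0r => [|j _]; last first.
  by rewrite ltn_eqF ?ltn_ord// mul0r.
rewrite big_ord_recl (tnth_nth 0)/= [_ ^+ _ * _]mulrC mulrA.
by congr (_ * _ * _); apply: eq_bigr => i _; rewrite tnthS.
Qed.

Lemma ipoly_sum m I (r : seq I) (F : I -> m.-tuple mR -> R) :
  (forall i, ipoly (F i)) -> ipoly (fun t => \sum_(i <- r) F i t).
Proof.
move=> iF; elim: r => [|i r IH].
  by rewrite (_ : (fun _ => _) = fun=> 0) ?funeqE => [|t]; [exact: ipoly0 | rewrite big_nil].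
rewrite (_ : (fun _ => _) = fun t => F i t + \sum_(j <- r) F j t).
  exact: ipolyD.
by apply/funext => t; rewrite big_cons.
Qed.

Lemma ipoly_measurable m (f : m.-tuple mR -> R) :
  ipoly f -> measurable_fun setT f.
Proof.
elim: m f => [|m IH] f /=.
  move=> _; rewrite (_ : f = cst (f [tuple])) //.
  by apply/funext => t; rewrite (tuple0 t).
move=> [n [c [pc fE]]].
rewrite (_ : f = fun t => \sum_(j < n) c j [tuple of behead t] * (tnth t ord0) ^+ j); last first.
  by apply/funext => t; rewrite [in LHS](tuple_eta t) fE.
apply: measurable_sum => j; apply: measurable_funM.
  by apply: measurableT_comp; [exact: IH | exact: measurable_behead].
by apply: measurable_funX; exact: measurable_tnth.
Qed.

(** Some coefficient is nonzero at the tail of [t0], so by induction it vanishes only on a null set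
    of tails. Over every other tail the slice is the root set of a nonzero univariate polynomial,
    hence finite. *)
Lemma ipoly_zero_null m (f : m.-tuple mR -> R) t0 : ipoly f -> f t0 != 0 ->
  measurable [set t | f t = 0] /\ lebesgue_tuple m [set t | f t = 0] = 0.
Proof.
move=> pf; split.
  rewrite (_ : mkset _ = f @^-1` [set 0]) // -[X in measurable X]setTI.
  by apply: ipoly_measurable.
elim: m f t0 pf H => [|m IH] f t0 pf f0.
  rewrite (_ : mkset _ = set0) ?measure0//; apply/seteqP; split=> // t /= ft.
  by move: f0; rewrite (tuple0 t0) -(tuple0 t) ft eqxx.
have mf := ipoly_measurable pf.
have mZ : measurable [set t | f t = 0].
  by rewrite (_ : mkset _ = f @^-1` [set 0]) // -[X in measurable X]setTI; exact: mf.
rewrite lebesgue_tuple_xsection//.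
move: pf => /= [n [c [pc fE]]].
have [j cj0] : exists j : 'I_n, c j [tuple of behead t0] != 0.
  apply: contrapT => /forallNP h; move: f0; rewrite (tuple_eta t0) fE big1 ?eqxx// => j _.
  by have /negP := h j; rewrite negbK => /eqP ->; rewrite mul0r.
have cZ := IH _ _ (pc j) cj0.
rewrite (ae_eq_integral (cst 0%E)) ?integral0//.
  pose A := @cons_pair R m @^-1` [set t | f t = 0].
  have mA : measurable A.
    by rewrite -[A]setTI; apply: measurable_cons_pair.
  rewrite (_ : (fun t => _) = (@lebesgue_measure R) \o xsection A).
    exact: measurable_fun_xsection.
  apply/funext => t /=; congr (lam _).
  by rewrite /xsection; apply/seteqP; split=> y; rewrite /= inE.
exists [set t | c j t = 0]; split=> //.
  by rewrite -[X in measurable X]setTI; exact: (ipoly_measurable (pc j) measurableT (measurable_set1 _)).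
move=> t /= /not_implyP[_]; apply: contra_notP => cjt.
pose p := \poly_(j < n) c j t.
have p0 : p != 0.
  apply: contra_notN cjt => /eqP p0.
  by have := coef_poly n (c ^~ t) j; rewrite -/p p0 coef0 ltn_ord => <-.
apply: countable_lebesgue_measure0; apply: finite_set_countable.
(* An infinite root set would contain at least [size p] distinct roots, more than the degree
   allows. *)
apply: contrapT => /(infinite_set_fset (size p)) [X XZ sX].
have : (size p < size p)%N; last by rewrite ltnn.
apply: leq_ltn_trans sX _; apply: max_poly_roots p0 _ (finmap.fset_uniq X).
apply/allP => y yX; have /= := XZ y yX; rewrite fE => fy.
by rewrite /root -[p]/(\poly_(_ < _) _) horner_poly fy.

Qed.

End TupleLebesgue.

(** * Polynomial functions *)

Section PolyFun.
Context {R : realType}.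
Notation mR := (measurableTypeR R).

Definition monomial_fun d (m : multinom d) (x : 'cV[R]_d) : R :=
  \prod_i x i 0 ^+ m i.

Section Closure.
Variables d k : nat.
Implicit Types f g : 'cV[R]_d -> R.

(** [bmultinom d k.+1] lists the exponents of total degree below k+1, in accordance with [msize],
    the degree plus one. The finite index type also provides spanning families and bounds. *)
Lemma poly_fun_monomials f : poly_fun k f ->
  exists c : bmultinom d k.+1 -> R,
    f = fun x => \sum_m c m * monomial_fun m x.
Proof.
move=> [p pk ->]; exists (fun m => mcoeff m p); apply/funext => x.
rewrite {1}(mpolywE pk) raddf_sum/=; apply: eq_bigr => m _.
by rewrite mevalZ mevalX.
Qed.

Lemma poly_fun_cst (a : R) : poly_fun k (fun _ : 'cV[R]_d => a).
Proof.
exists (mpolyC d a); last by apply/funext => x; rewrite mevalC.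
by rewrite mmeasureC; case: (a != 0).
Qed.

Lemma poly_funD f g : poly_fun k f -> poly_fun k g ->
  poly_fun k (fun x => f x + g x).
Proof.
move=> [p pk ->] [q qk ->]; exists (p + q); last by apply/funext => x; rewrite mevalD.
by rewrite (leq_trans (mmeasureD_le _ _ _))// geq_max pk.
Qed.

Lemma poly_funZ (a : R) f : poly_fun k f -> poly_fun k (fun x => a * f x).
Proof.
move=> [p pk ->]; exists (a *: p); last by apply/funext => x; rewrite mevalZ.
by rewrite (leq_trans (msizeZ_le _ _)).
Qed.

Lemma poly_fun_sum I (r : seq I) (P : pred I) (F : I -> 'cV[R]_d -> R) :
  (forall i, poly_fun k (F i)) -> poly_fun k (fun x => \sum_(i <- r | P i) F i x).
Proof.
move=> pF; elim: r => [|i r IH].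
  rewrite (_ : (fun _ => _) = fun=> 0); first exact: poly_fun_cst.
  by apply/funext => x; rewrite big_nil.
rewrite (_ : (fun _ => _) = fun x => (if P i then F i x else 0) +
    \sum_(i <- r | P i) F i x).
  by apply: poly_funD IH; case: (P i) => //; exact: poly_fun_cst.
by apply/funext => x; rewrite big_cons; case: ifP => // _; rewrite add0r.
Qed.

End Closure.

Lemma poly_fun_coord d (i : 'I_d) : poly_fun 1 (fun x : 'cV[R]_d => x i 0).
Proof.
exists (mpolyX R (mnm1 i)); last by apply/funext => x; rewrite mevalXU.
by rewrite msizeX mdeg1.
Qed.

Lemma poly_funW d k k' (f : 'cV[R]_d -> R) : (k <= k')%N ->
  poly_fun k f -> poly_fun k' f.
Proof. by move=> kk' [p pk ->]; exists p => //; apply: leq_trans pk _. Qed.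

Lemma poly_funM d j k (f g : 'cV[R]_d -> R) : poly_fun j f -> poly_fun k g ->
  poly_fun (j + k) (fun x => f x * g x).
Proof.
move=> [p pk ->] [q qk ->]; exists (p * q); last by apply/funext => x; rewrite mevalM.
have [->|p0] := eqVneq p 0; first by rewrite mul0r mmeasure0.
have [->|q0] := eqVneq q 0; first by rewrite mulr0 mmeasure0.
by rewrite msizeM// -subn1 leq_subLR add1n -addnS -addSn leq_add.
Qed.

Lemma poly_fun_prod d I (r : seq I) (e : I -> nat) (F : I -> 'cV[R]_d -> R) :
  (forall i, poly_fun (e i) (F i)) ->
  poly_fun (\sum_(i <- r) e i) (fun x => \prod_(i <- r) F i x).
Proof.
move=> pF; elim: r => [|i r IH].
  rewrite (_ : (fun _ => _) = fun=> 1); first exact: poly_fun_cst.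
  by apply/funext => x; rewrite big_nil.
rewrite big_cons (_ : (fun _ => _) = fun x => F i x * \prod_(i <- r) F i x).
  exact: poly_funM.
by apply/funext => x; rewrite big_cons.
Qed.

Lemma poly_funX d k (f : 'cV[R]_d -> R) n : poly_fun k f ->
  poly_fun (n * k) (fun x => f x ^+ n).
Proof.
move=> pf; rewrite (_ : (fun _ => _) = fun x => \prod_(i < n) f x).
  rewrite -[n in (n * _)%N]card_ord -sum_nat_const; exact: poly_fun_prod.
by apply/funext => x; rewrite prodr_const card_ord.
Qed.

Lemma poly_fun_affine m d (a : 'cV[R]_d) (B : 'M[R]_(d, m)) i :
  poly_fun 1 (fun x => (a + B *m x) i 0).
Proof.
rewrite (_ : (fun _ => _) = fun x : 'cV[R]_m => a i 0 + \sum_j B i j * x j 0).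
  apply: poly_funD; first exact: poly_fun_cst.
  by apply: poly_fun_sum => j; apply: poly_funZ; exact: poly_fun_coord.
by apply/funext => x; rewrite !mxE.
Qed.

(** An affine substitution turns the monomial of exponent [e] into a product of [mdeg e] affine
    functions, so the degree bound survives. It covers face charts and projections onto
    hyperplanes. *)
Lemma poly_fun_comp_affine m d k (f : 'cV[R]_d -> R) (a : 'cV[R]_d)
    (B : 'M[R]_(d, m)) : poly_fun k f -> poly_fun k (fun x => f (a + B *m x)).
Proof.
move=> /poly_fun_monomials[c ->]; apply: poly_fun_sum => e.
apply: poly_funZ; apply: (@poly_funW _ (mdeg e)); first by rewrite -ltnS bmdeg.
rewrite mdegE; apply: poly_fun_prod => i; rewrite -[X in poly_fun X]muln1.
apply: poly_funX; exact: poly_fun_affine.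
Qed.

Lemma poly_fun_ipoly d k (f : 'cV[R]_d -> R) : poly_fun k f ->
  ipoly (f \o @tcol R d).
Proof.
move=> /poly_fun_monomials[c ->].
rewrite (_ : _ \o _ = fun t : d.-tuple mR => \sum_m c m * \prod_i (tnth t i : R) ^+ m i).
  by apply: ipoly_sum => e; exact: ipoly_monomial.
apply/funext => t /=; apply: eq_bigr => e _; congr (_ * _).
by apply: eq_bigr => i _; rewrite mxE.
Qed.

Lemma poly_fun_measurable d k (f : 'cV[R]_d -> R) : poly_fun k f ->
  measurable_fun setT (f \o @tcol R d).
Proof. by move=> /poly_fun_ipoly/ipoly_measurable. Qed.

Lemma poly_fun_bounded d k (f : 'cV[R]_d -> R) (M : R) : poly_fun k f ->
  exists C, forall x : 'cV[R]_d, (forall i, `|x i 0| <= M) -> `|f x| <= C.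
Proof.
move=> /poly_fun_monomials[c ->].
exists (\sum_m `|c m| * \prod_(i < d) M ^+ m i) => x xM.
apply: le_trans (ler_norm_sum _ _ _) _; apply: ler_sum => e _.
rewrite normrM ler_wpM2l// normr_prod; apply: ler_prod => i _.
by rewrite normr_ge0 normrX lerXn2r// ?nnegrE// (le_trans _ (xM i)).
Qed.

Lemma poly_fun_zero_null d k (f : 'cV[R]_d -> R) x0 : poly_fun k f -> f x0 != 0 ->
  (lebesgue_tuple d).-negligible (@tcol R d @^-1` [set x | f x = 0]).
Proof.
move=> pf fx0; pose t0 : d.-tuple mR := mktuple (fun i => x0 i 0).
have ft0 : (f \o @tcol R d) t0 != 0.
  rewrite /= (_ : tcol t0 = x0)//; apply/colP => i.
  by rewrite mxE tnth_mktuple.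
have [mZ Z0] := ipoly_zero_null (poly_fun_ipoly pf) ft0.
by exists [set t | (f \o @tcol R d) t = 0]; split.
Qed.

End PolyFun.

(** * Sets of column vectors *)

Section Topology.
Context {R : realType}.
Notation mR := (measurableTypeR R).

Definition cube m (c : 'cV[R]_m) (e : R) : set 'cV[R]_m :=
  [set x | forall i, `|x i 0 - c i 0| < e].

Lemma tcol_cubeE m (c : 'cV[R]_m) e : @tcol R m @^-1` cube c e =
  [set t | forall i, `|tnth t i - tnth [tuple c i 0 | i < m] i| < e].
Proof.
by apply/seteqP; split=> t /= h i; have := h i; rewrite mxE tnth_mktuple.
Qed.

Lemma cube_measurable m (c : 'cV[R]_m) e : 0 < e ->
  measurable (@tcol R m @^-1` cube c e).
Proof. by move=> e0; rewrite tcol_cubeE; have [] := lebesgue_tuple_cube [tuple c i 0 | i < m] e0. Qed.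

Lemma cube_measure m (c : 'cV[R]_m) e : 0 < e ->
  lebesgue_tuple m (@tcol R m @^-1` cube c e) = ((e *+ 2) ^+ m)%:E.
Proof. by move=> e0; rewrite tcol_cubeE; have [] := lebesgue_tuple_cube [tuple c i 0 | i < m] e0. Qed.

Lemma cube_ball m (c : 'cV[R]_m) e : 0 < e -> cube c e `<=` ball c e.
Proof.
move=> e0 x xe; split=> // i j; rewrite /ball /= ord1 distrC; exact: xe.
Qed.

(** An open set is the union of the countably many rational cubes that it contains. This connects
    the norm topology of column vectors with the product sigma-algebra of tuples. *)
Lemma open_measurable_tcol m (U : set 'cV[R]_m) : open U ->
  measurable (@tcol R m @^-1` U).
Proof.
move=> oU.
pose box (z : 'cV[rat]_m * rat) : set 'cV[R]_m := cube (map_mx ratr z.1) (ratr z.2).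
pose I := [set z | 0 < z.2 /\ box z `<=` U].
have -> : @tcol R m @^-1` U = \bigcup_(z in I) (@tcol R m @^-1` box z).
  apply/seteqP; split=> [t /= Ut|t [z [_ zU]]]; last exact: zU.
  have /nbhs_ballP[e /= e0 eU] : nbhs (tcol t) U by exact: open_nbhs_nbhs.
  (* With r < e/2, a rational centre within r of the point gives a cube that contains the point and
     stays within 2r < e of it. *)
  have e2 : 0 < e / 2 by rewrite divr_gt0.
  have [r /[!in_itv]/= /andP[r0 re]] := rat_in_itvoo e2.
  have /choice[q qP] : forall i, exists q : rat, `|tcol t i 0 - ratr q| < ratr r.
    move=> i; have ti : tcol t i 0 - ratr r < tcol t i 0 + ratr r.
      by rewrite ltrBlDr -addrA ltrDl addr_gt0.
    have [q /[!in_itv]/= qi] := rat_in_itvoo ti.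
    by exists q; rewrite distrC ltr_distl.
  exists (\col_i q i, r) => [|i]; last by have := qP i; rewrite !mxE.
  split=> [|x /= xq]; first by rewrite -(ltr0q R).
  apply: eU; apply: cube_ball => // i.
  have := xq i; have := qP i; rewrite /= !mxE => ti xi.
  rewrite (splitr e) (le_lt_trans (ler_distD (ratr (q i)) _ _))//.
  by rewrite ltrD// ?(lt_trans xi)// distrC (lt_trans ti).
rewrite bigcup_mkcond; apply: countable_bigcupT_measurable => [|z]; first exact: countableP.
case: ifPn => // /set_mem[z0 _]; apply: cube_measurable.
by rewrite ltr0q.
Qed.

Lemma not_negligible_interior m (A : set 'cV[R]_m) : A° !=set0 ->
  ~ (lebesgue_tuple m).-negligible (@tcol R m @^-1` A).
Proof.
move=> [x] /nbhs_ballP[e /= e0 eA] [B [mB B0 AB]].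
have : (lebesgue_tuple m (@tcol R m @^-1` cube x e) <= lebesgue_tuple m B)%E.
  apply: le_measure; rewrite ?inE//; first exact: cube_measurable.
  by move=> t xt; apply: AB; apply: eA; exact: cube_ball.
by rewrite cube_measure// B0 lee_fin leNgt exprn_gt0// mulrn_wgt0.
Qed.

(** Otherwise the zero set of [f] and the exceptional set would be two null sets covering [A], which
    contains a cube. Hence even the values of a polynomial on a null set, such as a face, depend
    only on its almost everywhere class. *)
Lemma poly_fun_ae0 m k (A : set 'cV[R]_m) (f : 'cV[R]_m -> R) : A° !=set0 ->
  poly_fun k f -> ae_on A (fun x => f x = 0) -> forall x, f x = 0.
Proof.
move=> A0 pf fA x; apply: contrapT => /eqP fx.
apply: (not_negligible_interior A0).
have := negligibleU (poly_fun_zero_null pf fx) fA; apply: negligibleS => t /= At.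
by have [ft|ft] := pselect (f (tcol t) = 0); [left|right => /(_ At)].
Qed.

Definition coord_bounded m (A : set 'cV[R]_m) : Prop :=
  exists M, forall x, A x -> forall i, `|x i 0| <= M.

Lemma coord_bounded_finite m (A : set 'cV[R]_m) : coord_bounded A ->
  measurable (@tcol R m @^-1` A) ->
  (lebesgue_tuple m (@tcol R m @^-1` A) < +oo)%E.
Proof.
move=> [M AM] mA; pose e := Num.max M 0 + 1.
have e0 : 0 < e by rewrite ltr_wpDl// le_max lexx orbT.
apply: (@le_lt_trans _ _ (lebesgue_tuple m (@tcol R m @^-1` cube 0 e))).
  apply: le_measure; rewrite ?inE//; first exact: cube_measurable.
  move=> t /AM tM i; have := tM i; rewrite !mxE subr0 => ti; apply: (le_lt_trans ti).
  by rewrite ltr_pwDr// le_max lexx.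
by rewrite cube_measure// ltry.
Qed.

Lemma mx_continuous (T : topologicalType) m n (f : T -> 'M[R]_(m, n)) :
  (forall i j, continuous (fun x => f x i j)) -> continuous f.
Proof.
move=> fc x; apply/cvg_ballP => e e0.
suff : \forall y \near x, forall ij : 'I_m * 'I_n, ball (f x ij.1 ij.2) e (f y ij.1 ij.2).
  by apply: filterS => y h; split=> // i j; exact: (h (i, j)).
by apply: filter_forall => -[i j] /=; apply: (fc i j x); exact: nbhsx_ballx.
Qed.

End Topology.

(** * Polytopes and cones over faces: boundedness, closedness, measurability *)

Section Pyramids.
Context {R : realType}.

Lemma coord_boundedS m (A B : set 'cV[R]_m) : A `<=` B -> coord_bounded B ->
  coord_bounded A.
Proof. by move=> AB [M BM]; exists M => x /AB; exact: BM. Qed.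

Lemma coord_boundedU m (A B : set 'cV[R]_m) : coord_bounded A -> coord_bounded B ->
  coord_bounded (A `|` B).
Proof.
move=> [M AM] [N BN]; exists (Num.max M N) => x [/AM|/BN] xM i.
  by rewrite le_max xM.
by rewrite le_max xM orbT.
Qed.

Lemma conv_hull_bounded m (s : seq 'cV[R]_m) : coord_bounded (conv_hull s).
Proof.
exists (\sum_(j < size s) \sum_i `|s`_j i 0|) => x [w [w0 w1 ->]] i.
have wle j : w j <= 1 by rewrite -w1 (bigD1 j)//= lerDl sumr_ge0.
rewrite summxE (le_trans (ler_norm_sum _ _ _))//; apply: ler_sum => j _.
rewrite mxE normrM (ger0_norm (w0 j)) (bigD1 i)//=.
by rewrite ler_wpDr ?sumr_ge0// ler_piMl.
Qed.

Lemma polytope_bounded m (P : set 'cV[R]_m) : polytope P -> coord_bounded P.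
Proof.
move=> [[ss ->] _ _]; elim: ss => [|s ss IH]; first by exists 0 => x [].
apply: coord_boundedS (coord_boundedU (conv_hull_bounded s) IH) => x [s'].
by rewrite inE => /orP[/eqP ->|s's] xs; [left|right; exists s'].
Qed.

Lemma polytope_closed m (P : set 'cV[R]_m) : polytope P -> closed P.
Proof. by move=> [_ <- _]; exact: closed_closure. Qed.

Lemma polytope_interior m (P : set 'cV[R]_m) : polytope P -> P° !=set0.
Proof.
move=> [_ PE [x]]; rewrite -{1}PE => /(_ setT)[|y [yP _]]; first exact: filterT.
by exists y.
Qed.

Lemma closed_measurable_tcol m (A : set 'cV[R]_m) : closed A ->
  measurable (@tcol R m @^-1` A).
Proof.
move=> cA; rewrite -[A]setCK preimage_setC; apply: measurableC.
exact: (open_measurable_tcol (closed_openC cA)).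
Qed.

(** The cone is the continuous image of the compact set of pairs of a ratio in [0, 1] and a face
    parameter; parameters are transposed because [rV_compact] concerns row vectors. Closedness
    yields the measurability of pyramids. *)
Lemma cone_face_closed d (c : 'cV[R]_d) (F : flat_face R d) :
  closed (cone c (face_set F)).
Proof.
have [M FM] := polytope_bounded (face_param_polytope F).
have cF := polytope_closed (face_param_polytope F).
pose P := [set v : 'rV[R]_d.-1 | face_param F v^T].
have cP : compact P.
  apply: (@subclosed_compact _ P [set v : 'rV[R]_d.-1 | forall i, `[- M, M]%classic (v ord0 i)]).
  - apply: preimage_closed cF.
    move=> v _; apply: mx_continuous => i j.
    by under eq_fun do rewrite mxE; exact: coord_continuous.
  - apply: (@rV_compact _ _ (fun=> `[- M, M]%classic)) => _; exact: segment_compact.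
  - move=> v /FM vM i /=; have := vM i.
    by rewrite in_itv/= -ler_norml mxE.
pose g (z : R * 'rV[R]_d.-1) : 'cV[R]_d :=
  (1 - z.1) *: c + z.1 *: face_chart F z.2^T.
have -> : cone c (face_set F) = g @` (`[0, 1]%classic `*` P).
  apply/seteqP; split=> [x [t [_ [t01 [u Fu <-] ->]]]|_ [[t v] /= [t01 Pv] <-]].
    by exists (t, u^T); [split; rewrite /P /= ?trmxK// in_itv | rewrite /g /= trmxK].
  by exists t, (face_chart F v^T); split=> //; exists v^T.
apply: compact_closed; first exact: norm_hausdorff.
apply: continuous_compact; last by apply: compact_setX => //; exact: segment_compact.
apply: continuous_subspaceT; apply: mx_continuous => i j z.
pose h (z : R * 'rV[R]_d.-1) := (1 - z.1) * c i j + z.1 * (face_origin F i j +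
   \sum_k face_frame F i k * z.2 j k).
have -> : (fun z => g z i j) = h.
  by apply/funext => y; rewrite /g /h !mxE; congr (_ + _ * (_ + _)); apply: eq_bigr => k _; rewrite mxE.
apply: cvgD.
  by apply: cvgM; [apply: cvgB; [exact: cvg_cst|exact: cvg_fst]|exact: cvg_cst].
apply: cvgM; first exact: cvg_fst.
apply: cvgD; first exact: cvg_cst.
apply: cvg_big => [|k _]; first exact: add_continuous.
apply: cvgM; first exact: cvg_cst.
apply: (@continuous_comp _ _ _ snd (fun v : 'rV[R]_d.-1 => v j k)); first exact: cvg_snd.
exact: coord_continuous.
Qed.

End Pyramids.

(** * Convex sets *)

Section Convex.
Context {R : realType}.

Definition convex_in (E : lmodType R) (A : set E) : Prop :=
  forall x y t, A x -> A y -> 0 <= t <= 1 -> A ((1 - t) *: x + t *: y).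

Lemma convex_in_sum (E : lmodType R) (A : set E) n (w : 'I_n -> R) (p : 'I_n -> E) :
  convex_in A -> (forall i, 0 <= w i) -> \sum_i w i = 1 -> (forall i, A (p i)) ->
  A (\sum_i w i *: p i).
Proof.
move=> cA; elim: n w p => [|n IH] w p w0 w1 Ap.
  by move/eqP: w1; rewrite big_ord0 eq_sym oner_eq0.
pose t := w ord_max; pose v i := w (widen_ord (leqnSn n) i).
have sv : \sum_i v i = 1 - t by rewrite -w1 big_ord_recr/= addrK.
(* If the last weight is 1, the other weights vanish and cannot be renormalised by [1 - t]. *)
have [t1|t1] := eqVneq t 1.
  rewrite big_ord_recr/= -/t t1 scale1r big1 ?add0r// => i _.
  have sv0 : \sum_i v i = 0 by rewrite sv t1 subrr.
  by rewrite (psumr_eq0P (fun i _ => w0 _) sv0)// scale0r.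
have t1' : 1 - t != 0 by rewrite subr_eq0 eq_sym.
have s0 : 0 <= 1 - t by rewrite -sv; apply: sumr_ge0 => i _; exact: w0.
rewrite big_ord_recr/= -/t (_ : \sum_(i < n) _ =
    (1 - t) *: \sum_i (v i / (1 - t)) *: p (widen_ord (leqnSn n) i)).
  apply: cA => //; last by rewrite w0 -subr_ge0 s0.
  apply: IH => // [i|]; first by rewrite divr_ge0// w0.
  by rewrite -mulr_suml sv divff.
by rewrite scaler_sumr; apply: eq_bigr => i _; rewrite scalerA mulrC divfK.
Qed.

Lemma convex_inI (E : lmodType R) (A B : set E) :
  convex_in A -> convex_in B -> convex_in (A `&` B).
Proof. by move=> cA cB x y t [xA xB] [yA yB] t01; split; [exact: cA|exact: cB]. Qed.

Lemma conv_hull_convex m (s : seq 'cV[R]_m) : convex_in (conv_hull s).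
Proof.
move=> _ _ t [w [w0 w1 ->]] [v [v0 v1 ->]] /andP[t0 t1].
exists (fun i => (1 - t) * w i + t * v i); split=> [i||].
- by rewrite addr_ge0 ?mulr_ge0// subr_ge0.
- by rewrite big_split/= -!mulr_sumr w1 v1 !mulr1 subrK.
- rewrite !scaler_sumr -big_split/=; apply: eq_bigr => i _.
  by rewrite !scalerA -scalerDl.
Qed.

Lemma face_chart_convex d (F : flat_face R d) (A : set 'cV[R]_d.-1) :
  convex_in A -> convex_in (face_chart F @` A).
Proof.
move=> cA _ _ t [u Au <-] [v Av <-] t01.
exists ((1 - t) *: u + t *: v); first exact: cA.
rewrite /face_chart mulmxDr -!scalemxAr !scalerDr addrACA -scalerDl subrK.
by rewrite scale1r.
Qed.

Lemma cone_convex d (c : 'cV[R]_d) (A : set 'cV[R]_d) :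
  convex_in A -> convex_in (cone c A).
Proof.
move=> cA _ _ l [s [x [/andP[s0 s1] Ax ->]]] [t [y [/andP[t0 t1] Ay ->]]] /andP[l0 l1].
have l1' : 0 <= 1 - l by rewrite subr_ge0.
pose r := (1 - l) * s + l * t.
have lt_ge0 : 0 <= l * t by exact: mulr_ge0.
have ls_ge0 : 0 <= (1 - l) * s by exact: mulr_ge0.
have r0 : 0 <= r by exact: addr_ge0.
have r1 : r <= 1.
  by rewrite -[leRHS](subrK l) lerD// ler_piMr.
have E1 : (1 - l) *: ((1 - s) *: c + s *: x) + l *: ((1 - t) *: c + t *: y) =
    (1 - r) *: c + (((1 - l) * s) *: x + (l * t) *: y).
  rewrite !scalerDr !scalerA addrACA -scalerDl; congr (_ *: _ + _).
  by rewrite /r; ring.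
(* For r = 0 the point is the apex and any base point serves; otherwise the base point is the
   combination of x and y in which y has weight lt/r. *)
rewrite E1; have [r_eq0|r_neq0] := eqVneq r 0.
  exists 0, x; split; rewrite ?lexx ?ler01//; move/eqP: r_eq0.
  rewrite paddr_eq0// => /andP[/eqP ls /eqP lt].
  by rewrite /r ls lt !scale0r !addr0.
exists r, ((1 - (l * t) / r) *: x + ((l * t) / r) *: y); split.
- by rewrite r0.
- apply: cA => //; rewrite divr_ge0//= ler_pdivrMr ?lt_def ?r_neq0//.
  by rewrite mul1r lerDr.
- congr (_ + _); rewrite scalerDr !scalerA [r * (_ / r)]mulrC divfK//.
  by rewrite mulrBr mulr1 [r * (_ / r)]mulrC divfK// /r addrK.
Qed.

(** Choose differences [v - v0] of maximal rank. At rank d some of them form an invertible matrix;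
    below it every difference lies in their row space, and a nonzero column of the cokernel is
    normal to a hyperplane through [v0] containing [A]. *)
Lemma affine_dichotomy d (A : set 'cV[R]_d) (v0 : 'cV[R]_d) :
  (exists2 M : 'M[R]_d, M \in unitmx & forall i, A (v0 + (row i M)^T)) \/
  (exists2 a : 'cV[R]_d, a != 0 & forall v, A v -> (v - v0)^T *m a = 0).
Proof.
pose P r := `[< exists n (M : 'M[R]_(n, d)), \rank M = r /\ forall i, A (v0 + (row i M)^T) >].
have P0 : exists r, P r.
  exists 0; apply/asboolP; exists 0, 0; split; first by rewrite mxrank0.
  by case.
have Pd r : P r -> (r <= d)%N by move=> /asboolP[n [M [<- _]]]; exact: rank_leq_col.
case: (ex_maxnP P0 Pd) => r /asboolP[n [M [rM AM]]] rmax.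
have [Mfull|Mnfull] := boolP (row_full M).
  left; exists (rowsub (fullrankfun Mfull) M); first exact: fullrowsub_unit.
  by move=> i; rewrite row_rowsub.
right.
have sub v : A v -> ((v - v0)^T <= M)%MS.
  move=> Av; apply: contrapT => /negP nsub.
  have : (r < \rank (col_mx M (v - v0)^T))%N.
    rewrite -addsmxE -rM ltn_neqAle mxrankS ?addsmxSl// andbT.
    apply: contraNN nsub => /eqP e.
    have := mxrank_leqif_sup (addsmxSl M (v - v0)^T).
    by move=> -[_]; rewrite e eqxx => /esym; rewrite addsmx_sub => /andP[].
  rewrite ltnNge => /negP; apply; apply: rmax; apply/asboolP.
  exists (n + 1)%N, (col_mx M (v - v0)^T); split=> // i.
  case: (split_ordP i) => j ->; first by rewrite rowKu.
  by rewrite rowKd row_id trmxK addrC subrK.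
have /matrix0Pn[i [j Mij]] : cokermx M != 0 by rewrite cokermx_eq0.
exists (col j (cokermx M)).
  by apply/matrix0Pn; exists i, 0; rewrite mxE.
move=> v /sub/submxP[B ->]; rewrite -mulmxA colE.
by rewrite [M *m (cokermx M *m _)]mulmxA mulmx_coker mul0mx mulmx0.
Qed.

Lemma convex_negligible d (A : set 'cV[R]_d) : convex_in A -> A° = set0 ->
  (lebesgue_tuple d).-negligible (@tcol R d @^-1` A).
Proof.
move=> cA intA.
have [->|/set0P[v0 Av0]] := eqVneq A set0.
  by rewrite preimage_set0; exact: negligible_set0.
have [[M Mu AM]|[a a0 Aa]] := affine_dichotomy A v0; last first.
  have [i [j aij]] : exists i j, a i j != 0 by exact/matrix0Pn.
  pose f (x : 'cV[R]_d) := \sum_i (- v0 + 1%:M *m x) i 0 * a i 0.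
  have pf : poly_fun 1 f.
    apply: poly_fun_sum => k; under eq_fun do rewrite mulrC.
    by apply: poly_funZ; exact: poly_fun_affine.
  have fx : f (v0 + delta_mx i 0) != 0.
    rewrite /f mul1mx addKr (bigD1 i)//= big1 ?addr0.
      by rewrite mxE !eqxx mul1r -(ord1 j).
    by move=> k ki; rewrite mxE (negbTE ki) mul0r.
  apply: negligibleS (poly_fun_zero_null pf fx) => t /= At.
  have /matrixP/(_ 0 0) := Aa _ At; rewrite !mxE => <-.
  by apply: eq_bigr => k _; rewrite mul1mx addrC !mxE.
(* The barycentre of the simplex with vertices [v0] and [v0 + (row i M)^T]: all its barycentric
   coordinates equal 1/(d+1). They depend continuously on the point ([L] gives those other than that
   of [v0]), so they stay positive nearby. *)
suff : A° (v0 + d.+1%:R^-1 *: (\sum_i row i M)^T) by rewrite intA.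
pose L (y : 'cV[R]_d) : 'rV[R]_d := (y - v0)^T *m invmx M.
have Lc i : continuous (fun y => L y 0 i).
  rewrite (_ : (fun y : 'cV[R]_d => _) = fun y => \sum_k (y k 0 - v0 k 0) * invmx M k i).
    apply: continuous_big => [|k _ y]; first exact: add_continuous.
    exact: (cvgM (cvgB (@coord_continuous R d 1 k 0 y) (cvg_cst _)) (cvg_cst _)).
  by apply/funext => y; rewrite mxE; apply: eq_bigr => k _; rewrite !mxE.
have LA y : (forall i, 0 < L y 0 i) -> \sum_i L y 0 i < 1 -> A y.
  move=> L0 L1.
  pose w (i : 'I_d.+1) := if unlift ord0 i is Some j then L y 0 j else 1 - \sum_i L y 0 i.
  pose p (i : 'I_d.+1) := if unlift ord0 i is Some j then v0 + (row j M)^T else v0.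
  have -> : y = \sum_i w i *: p i.
    rewrite big_ord_recl /w /p unlift_none.
    under [X in _ = _ + X]eq_bigr do rewrite liftK scalerDr.
    rewrite big_split/= -scaler_suml addrA -scalerDl subrK scale1r.
    rewrite -[LHS](subrK v0) addrC; congr (_ + _).
    apply: trmx_inj; rewrite -[LHS](mulmxKV Mu) -/(L y) [LHS]mulmx_sum_row.
    by rewrite linear_sum/=; apply: eq_bigr => i _; rewrite linearZ/= trmxK.
  apply: convex_in_sum => // [i||i].
  - rewrite /w; case: unliftP => [j _|_]; first exact: ltW.
    by rewrite subr_ge0 ltW.
  - rewrite big_ord_recl /w unlift_none.
    by under [X in _ + X = _]eq_bigr do rewrite liftK; rewrite subrK.
  - by rewrite /p; case: unliftP.
set x0 := v0 + _.
have Lx0 i : L x0 0 i = d.+1%:R^-1.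
  rewrite /L /x0 addrAC subrr add0r linearZ/= trmxK -scalemxAl.
  rewrite (_ : \sum_j row j M = const_mx 1 *m M) ?mulmxK ?mxE ?mulr1//.
  by rewrite mulmx_sum_row; apply: eq_bigr => j _; rewrite mxE scale1r.
have n1 : \forall y \near x0, forall i, 0 < L y 0 i.
  apply: (@filter_forall _ _ _ (nbhs x0)) => i.
  have gt0 : nbhs (L x0 0 i) [set z : R | 0 < z].
    by apply: open_nbhs_nbhs; split; [exact: open_gt|rewrite /= Lx0 invr_gt0].
  exact: (Lc i x0 _ gt0).
have n2 : \forall y \near x0, \sum_i L y 0 i < 1.
  have Sc : continuous (fun y => \sum_i L y 0 i).
    by apply: continuous_big => [|i _]; [exact: add_continuous|exact: Lc].
  have lt1 : nbhs (\sum_i L x0 0 i) [set z : R | z < 1].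
    apply: open_nbhs_nbhs; split; first exact: open_lt.
    rewrite /= (eq_bigr _ (fun i _ => Lx0 i)) sumr_const card_ord -[X in X < _]mulr_natr.
    by rewrite mulrC ltr_pdivrMr// mul1r ltr_nat.
  exact: (Sc x0 _ lt1).
by apply: filterS2 n1 n2 => y; exact: LA.
Qed.

End Convex.

(** * Square integrable functions *)

Section SquareIntegrable.
Context {R : realType} (d : nat) (A : set 'cV[R]_d).
Hypothesis mA : measurable (@tcol R d @^-1` A).
Implicit Types f g : 'cV[R]_d -> R.
Notation mu := (lebesgue_tuple d).
Notation D := (@tcol R d @^-1` A).

Lemma sqint_integrable f : square_integrable_on A f ->
  mu.-integrable D (EFin \o (fun t => f (tcol t) ^+ 2)).
Proof.
move=> [mf fi]; apply/integrableP; split.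
  by apply/measurable_EFinP; exact: measurable_funX.
apply: le_lt_trans fi; rewrite le_eqVlt; apply/orP; left; apply/eqP.
by apply: eq_integral => t _ /=; rewrite ger0_norm// sqr_ge0.
Qed.

Lemma sqint_mul_integrable f g :
  square_integrable_on A f -> square_integrable_on A g ->
  mu.-integrable D (EFin \o (fun t => f (tcol t) * g (tcol t))).
Proof.
move=> f2 g2; apply: le_integrable (integrableD mA (sqint_integrable f2) (sqint_integrable g2)) => //.
  by apply/measurable_EFinP; apply: measurable_funM; [exact: f2.1|exact: g2.1].
move=> t _ /=; rewrite lee_fin [leRHS]ger0_norm ?addr_ge0 ?sqr_ge0//.
rewrite normrM -[f _ ^+ 2]real_normK ?num_real// -[g _ ^+ 2]real_normK ?num_real//.
set a := `|f _|; set b := `|g _|.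
rewrite -subr_ge0 (_ : _ - _ = (2^-1 * (a - b) ^+ 2 + 2^-1 * (a ^+ 2 + b ^+ 2))); last by field.
by rewrite addr_ge0// mulr_ge0 ?invr_ge0 ?ler0n ?addr_ge0 ?sqr_ge0.
Qed.

Lemma integrable_sqint f : measurable_fun D (f \o @tcol R d) ->
  mu.-integrable D (EFin \o (fun t => f (tcol t) ^+ 2)) -> square_integrable_on A f.
Proof.
move=> mf /integrableP[_ fi]; split=> //; apply: le_lt_trans fi.
rewrite le_eqVlt; apply/orP; left; apply/eqP.
by apply: eq_integral => t _ /=; rewrite ger0_norm// sqr_ge0.
Qed.

Lemma sqintD f g : square_integrable_on A f -> square_integrable_on A g ->
  square_integrable_on A (fun x => f x + g x).
Proof.
move=> f2 g2; apply: integrable_sqint.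
  by apply: measurable_funD; [exact: f2.1|exact: g2.1].
have i1 := integrableD mA (sqint_integrable f2) (sqint_integrable g2).
have i2 := integrableZl mA 2 (sqint_mul_integrable f2 g2).
apply: eq_integrable (integrableD mA i1 i2) => // t _ /=.
by rewrite -!EFinM -!EFinD; congr EFin; ring.
Qed.

Lemma sqintZ (a : R) f : square_integrable_on A f ->
  square_integrable_on A (fun x => a * f x).
Proof.
move=> f2; apply: integrable_sqint.
  by apply: measurable_funM; [exact: measurable_cst|exact: f2.1].
apply: eq_integrable (integrableZl mA (a ^+ 2) (sqint_integrable f2)) => // t _ /=.
by rewrite -!EFinM exprMn.
Qed.

Lemma sqint_indic (B : set 'cV[R]_d) f : measurable (@tcol R d @^-1` B) ->
  square_integrable_on A f -> square_integrable_on A (fun x => \1_B x * f x).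
Proof.
move=> mB f2; have m1 : measurable_fun D (fun t => \1_B (tcol t) * f (tcol t)).
  apply: measurable_funM; last exact: f2.1.
  rewrite (_ : (fun t => _) = \1_(@tcol R d @^-1` B)); first exact: measurable_indic.
  by apply/funext => t; rewrite !indicE.
apply: integrable_sqint => //.
apply: le_integrable (sqint_integrable f2) => //.
  by apply/measurable_EFinP; apply: measurable_funX.
move=> t _ /=; rewrite lee_fin !ger0_norm ?sqr_ge0// exprMn ler_piMl ?sqr_ge0//.
Qed.

Lemma poly_fun_sqint k f : coord_bounded A -> poly_fun k f -> square_integrable_on A f.
Proof.
move=> bA pf; have [M AM] := bA.
have [C fC] := poly_fun_bounded M pf.
have mf : measurable_fun D (f \o @tcol R d) by apply: measurable_funTS; exact: poly_fun_measurable pf.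
apply: integrable_sqint => //; apply: measurable_bounded_integrable => //.
- exact: coord_bounded_finite.
- exact: measurable_funX.
exists (C ^+ 2); split; first exact: num_real.
move=> y Cy t At /=; apply: le_trans (ltW Cy); rewrite normrX lerXn2r ?nnegrE//.
  by apply: le_trans (fC _ (AM _ At)).
exact: fC (AM _ At).
Qed.

Lemma integral_on_ge0_eq0 f : mu.-integrable D (EFin \o (f \o @tcol R d)) ->
  (forall x, A x -> 0 <= f x) -> integral_on A f = 0 -> ae_on A (fun x => f x = 0).
Proof.
move=> fi f0 If; have mf := measurable_int _ fi.
have If0 : (\int[mu]_(t in D) `|(f (tcol t))%:E|)%E = 0.
  rewrite (eq_integral (fun t => (f (tcol t))%:E)); last first.
    by move=> t /set_mem At; rewrite gee0_abs// lee_fin f0.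
  (* The real integral is [fine] of the extended one, which also sends infinities to 0;
     integrability excludes them. *)
  rewrite -[LHS]fineK; first by congr EFin.
  exact: (integrable_fin_num mA fi).
have /(ae_eq_integral_abs mu mA mf) h := If0.
by apply: filterS h => t /= ft At; have [] := ft At.
Qed.

Lemma integral_on_ae0 f : measurable_fun D (f \o @tcol R d) ->
  ae_on A (fun x => f x = 0) -> integral_on A f = 0.
Proof.
move=> mf f0; rewrite /integral_on /Rintegral (ae_eq_integral (cst 0%E))//.
- by rewrite integral0.
- exact/measurable_EFinP.
- apply: (@filterS _ _ (ae_filter_ringOfSetsType mu) _ _ _ f0) => t /= ft At; by rewrite ft.
Qed.

End SquareIntegrable.

(** * Pyramids *)

Section AlmostEverywhere.
Context {R : realType} (d : nat).
Implicit Types (A B : set 'cV[R]_d) (P Q S : 'cV[R]_d -> Prop).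

Lemma ae_onW A P : (forall x, A x -> P x) -> ae_on A P.
Proof. by move=> AP; apply: aeW => t; exact: AP. Qed.

Lemma ae_onS A B P : B `<=` A -> ae_on A P -> ae_on B P.
Proof.
move=> BA AP; apply: (@filterS _ _ (ae_filter_ringOfSetsType _) _ _ _ AP) => t.
by move=> + /BA; exact.
Qed.

Lemma ae_on_impl A P Q : (forall x, A x -> P x -> Q x) -> ae_on A P -> ae_on A Q.
Proof.
move=> PQ AP; apply: (@filterS _ _ (ae_filter_ringOfSetsType _) _ _ _ AP) => t.
by move=> Pt At; apply: PQ => //; exact: Pt.
Qed.

Lemma ae_on_impl2 A P Q S : (forall x, A x -> P x -> Q x -> S x) ->
  ae_on A P -> ae_on A Q -> ae_on A S.
Proof.
move=> PQS AP AQ.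
apply: (@filterS2 _ _ (ae_filter_ringOfSetsType _) _ _ _ _ AP AQ) => t.
by move=> Pt Qt At; apply: PQS => //; [exact: Pt|exact: Qt].
Qed.

Lemma ae_on_forall (I : finType) A (P : I -> 'cV[R]_d -> Prop) :
  (forall i, ae_on A (P i)) -> ae_on A (fun x => forall i, P i x).
Proof.
move=> AP; have h := @filter_forall _ _ _ _ (ae_filter_ringOfSetsType _) AP.
apply: (@filterS _ _ (ae_filter_ringOfSetsType _) _ _ _ h) => t Pt At i.
exact: Pt.
Qed.

Lemma ae_on_bigcup (I : finType) (T : I -> set 'cV[R]_d) P :
  (forall i, ae_on (T i) P) -> ae_on (\bigcup_i T i) P.
Proof.
move=> TP; have h := @filter_forall _ _ _ _ (ae_filter_ringOfSetsType _) TP.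
apply: (@filterS _ _ (ae_filter_ringOfSetsType _) _ _ _ h) => t Pt [i _ Tt].
exact: Pt Tt.
Qed.

End AlmostEverywhere.

(** * Pyramids cover the polytope and overlap in null sets *)

Section Mesh.
Context {R : realType} (d : nat) (K : star_polytope R d).
Implicit Types i j : 'I_(nfaces K).

Lemma carrier_measurable : measurable (@tcol R d @^-1` carrier K).
Proof. exact: (closed_measurable_tcol (polytope_closed (carrier_polytope K))). Qed.

Lemma carrier_bounded : coord_bounded (carrier K).
Proof. exact: (polytope_bounded (carrier_polytope K)). Qed.

Lemma pyramid_measurable i : measurable (@tcol R d @^-1` pyramid i).
Proof.
have closed_pyramid : closed (pyramid i) by exact: cone_face_closed.
exact: (closed_measurable_tcol closed_pyramid).
Qed.

Lemma carrierE : carrier K = \bigcup_i @pyramid R d K i.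
Proof. by have [] := center_pyramids K. Qed.

Lemma pyramid_sub i : pyramid i `<=` carrier K.
Proof. by move=> x ix; rewrite carrierE; exists i. Qed.

Lemma pyramid_interior i : (pyramid i)° !=set0.
Proof. by have [_ + _] := center_pyramids K; exact. Qed.

(** The parameter set of a face is a finite union of convex hulls, so each pyramid is a finite union
    of convex cones. Two cones from different pyramids meet in a convex set whose interior lies in
    that of both pyramids, hence is empty. *)
Lemma pyramid_overlap i j : i != j -> ae_on (pyramid i) (fun x => ~ pyramid j x).
Proof.
move=> ij; have [_ _ /(_ i j ij) T0] := center_pyramids K.
have [[ss Fi] _ _] := face_param_polytope (face i).
have [[rr Fj] _ _] := face_param_polytope (face j).
pose C (l : 'I_(nfaces K)) (s : seq 'cV[R]_d.-1) :=
  cone (Defs.center K) (face_chart (face l) @` conv_hull s).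
(* Pieces are indexed by all natural numbers: past the end of a list the default [[::]] has an empty
   hull, and the cone over it is empty too. *)
pose N (n m : nat) := @tcol R d @^-1` (C i (nth [::] ss n) `&` C j (nth [::] rr m)).
have hull0 (u : 'cV[R]_d.-1) : ~ conv_hull [::] u.
  by move=> [w [_ + _]]; rewrite big_ord0 => /eqP; rewrite eq_sym oner_eq0.
have CT l (s : seq (seq 'cV[R]_d.-1)) n :
    face_param (face l) = [set x | exists2 r, r \in s & conv_hull r x] ->
    C l (nth [::] s n) `<=` pyramid l.
  move=> Fl _ [t [y [t01 [u us <-] ->]]]; exists t, (face_chart (face l) u).
  split=> //; exists u => //; rewrite Fl; exists (nth [::] s n) => //.
  by have [ns|ns] := ltnP n (size s); [exact: mem_nth|rewrite nth_default// in us; have := hull0 _ us].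
have TC l (s : seq (seq 'cV[R]_d.-1)) x :
    face_param (face l) = [set x | exists2 r, r \in s & conv_hull r x] ->
    pyramid l x -> exists n, C l (nth [::] s n) x.
  move=> Fl [t [y [t01 [u + <-] ->]]]; rewrite Fl => -[r rs ru].
  exists (index r s); exists t, (face_chart (face l) u); split=> //.
  by exists u => //; rewrite nth_index.
apply: negligibleS (_ : (lebesgue_tuple d).-negligible (\bigcup_n \bigcup_m N n m)).
  move=> t /= /not_implyP[ti /contrapT tj].
  have [n ni] := TC _ _ _ Fi ti; have [m mj] := TC _ _ _ Fj tj.
  by exists n => //; exists m.
apply: negligible_bigcup => n; apply: negligible_bigcup => m.
apply: convex_negligible.
  by apply: convex_inI; apply/cone_convex/face_chart_convex/conv_hull_convex.
rewrite -subset0 -T0 -interiorI; apply: subset_trans.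
  apply: interiorS; exact: (setISS (CT i ss n Fi) (CT j rr m Fj)).
by [].
Qed.

End Mesh.

(** * Bases modulo a subspace *)

Section QuotientBases.
Context {R : realType}.

Definition subspace_set (E : lmodType R) (V : set E) : Prop :=
  V 0 /\ forall (a : R) x y, V x -> V y -> V (a *: x + y).

Section Subspace.
Context (E : lmodType R) (V : set E).
Hypothesis subV : subspace_set V.

Lemma subspace0 : V 0. Proof. exact: subV.1. Qed.

Lemma subspaceZ a x : V x -> V (a *: x).
Proof. by move=> Vx; rewrite -[_ *: _]addr0; apply: subV.2 => //; exact: subV.1. Qed.

Lemma subspaceD x y : V x -> V y -> V (x + y).
Proof. by move=> Vx Vy; rewrite -[x]scale1r; exact: subV.2. Qed.

Lemma subspaceN x : V x -> V (- x).
Proof. by rewrite -scaleN1r; exact: subspaceZ. Qed.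

Lemma subspaceB x y : V x -> V y -> V (x - y).
Proof. by move=> Vx Vy; apply: subspaceD => //; exact: subspaceN. Qed.

Lemma subspace_sum I (r : seq I) (P : pred I) (F : I -> E) :
  (forall i, P i -> V (F i)) -> V (\sum_(i <- r | P i) F i).
Proof. by move=> VF; apply: big_ind => //; [exact: subspace0|exact: subspaceD]. Qed.

Lemma subspace_lincomb (I : finType) (c : I -> R) (e : I -> E) :
  (forall i, V (e i)) -> V (\sum_i c i *: e i).
Proof. by move=> Ve; apply: subspace_sum => i _; exact: subspaceZ. Qed.

End Subspace.

Definition independent_mod (E : lmodType R) (Z : set E) m (e : 'I_m -> E) :=
  forall c : 'I_m -> R, Z (\sum_i c i *: e i) -> forall i, c i = 0.

(** If m exceeds the number of generators, the coordinate matrix has a nonzero left kernel vector;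
    combining the [e j] with it cancels the generators and leaves a combination of elements of
    [Z]. *)
Lemma independent_mod_bound (E : lmodType R) (Z : set E) (I : finType)
    (g : I -> E) m (e : 'I_m -> E) : subspace_set Z ->
  (forall j, exists c : I -> R, Z (e j - \sum_i c i *: g i)) ->
  independent_mod Z e -> (m <= #|I|)%N.
Proof.
move=> sZ /choice[C CZ] indep; rewrite leqNgt; apply/negP => Im.
pose M : 'M[R]_(m, #|I|) := \matrix_(j, k) C j (enum_val k).
have /matrix0Pn[k [l kl]] : kermx M != 0.
  rewrite kermx_eq0 /row_free neq_ltn (leq_ltn_trans (rank_leq_col M))//.
pose v j := kermx M k j.
have vM i : \sum_j v j * C j i = 0.
  have /matrixP/(_ k (enum_rank i)) := mulmx_ker M; rewrite mxE [RHS]mxE => kM0.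
  rewrite -[RHS]kM0; apply: eq_bigr => j _; by rewrite [M j _]mxE enum_rankK.
suff /indep/(_ l) : Z (\sum_j v j *: e j) by move/eqP; rewrite (negbTE kl).
have -> : \sum_j v j *: e j = \sum_j v j *: (e j - \sum_i C j i *: g i).
  under [RHS]eq_bigr do rewrite scalerBr scaler_sumr.
  rewrite sumrB exchange_big/= [X in _ - X]big1 ?subr0// => i _.
  by under eq_bigr do rewrite scalerA; rewrite -scaler_suml vM scale0r.
exact: subspace_lincomb.
Qed.

(** The family [g] may lie outside [V]: it serves to bound the size of independent families in [V],
    and one of maximal size is a basis. *)
Lemma has_dim_mod_exists (E : lmodType R) (Z V : set E) (I : finType) (g : I -> E) :
  subspace_set Z -> subspace_set V ->
  (forall x, V x -> exists c : I -> R, Z (x - \sum_i c i *: g i)) ->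
  exists m, has_dim_mod Z V m.
Proof.
move=> sZ sV span.
pose P m := `[< exists2 e : 'I_m -> E, (forall i, V (e i)) & independent_mod Z e >].
have P0 : exists m, P m.
  exists 0; apply/asboolP; exists (fun=> 0) => [[]//|c _ []//].
have Pbound m : P m -> (m <= #|I|)%N.
  move=> /asboolP[e Ve ie]; apply: (independent_mod_bound sZ _ ie) => j.
  exact: span.
case: (ex_maxnP P0 Pbound) => m /asboolP[e Ve ie] mmax.
exists m, e; split=> // x Vx.
pose e' (i : 'I_m.+1) := if unlift ord0 i is Some j then e j else x.
have /existsNP[c /not_implyP[Zc /existsNP[i0 ci0]]] : ~ independent_mod Z e'.
  move=> ie'; have : (m.+1 <= m)%N; last by rewrite ltnn.
  apply: mmax; apply/asboolP; exists e' => // i.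
  by rewrite /e'; case: unliftP.
move: Zc; rewrite big_ord_recl /e' unlift_none.
under eq_bigr do rewrite liftK.
move=> Zc; have c0 : c ord0 != 0.
  apply: contra_notN ci0 => /eqP c0; move: Zc; rewrite c0 scale0r add0r => /ie ci.
  by case: (unliftP ord0 i0) => [j ->|->].
exists (fun i => - (c (lift ord0 i) / c ord0)).
have -> : x - \sum_i - (c (lift ord0 i) / c ord0) *: e i =
    (c ord0)^-1 *: (c ord0 *: x + \sum_(i < m) c (lift ord0 i) *: e i).
  rewrite scalerDr scalerA mulVf// scale1r scaler_sumr -sumrN; congr (_ + _).
  by apply: eq_bigr => i _; rewrite scaleNr opprK scalerA mulrC.
exact: subspaceZ.
Qed.

(** A left kernel vector of [G] annihilates the quadratic form, so definiteness makes the matrix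
    invertible. This solves the normal equations of an orthogonal projection. *)
Lemma gram_solve m (G : 'I_m -> 'I_m -> R) :
  (forall c : 'I_m -> R, \sum_i \sum_j c i * c j * G i j = 0 -> forall i, c i = 0) ->
  forall v : 'I_m -> R, exists c : 'I_m -> R, forall j, \sum_i c i * G i j = v j.
Proof.
move=> Gdef v; pose M : 'M[R]_m := \matrix_(i, j) G i j.
have Mu : M \in unitmx.
  rewrite -row_free_unit -kermx_eq0; apply/eqP/row_matrixP => k; rewrite row0.
  have kM : row k (kermx M) *m M = 0 by rewrite -row_mul mulmx_ker row0.
  apply/rowP => i; rewrite mxE [RHS]mxE.
  apply: (Gdef (fun i => kermx M k i)); rewrite exchange_big/= big1// => j _.
  have /matrixP/(_ 0 j) := kM; rewrite mxE [RHS]mxE => E0.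
  transitivity (kermx M k j * \sum_i row k (kermx M) 0 i * M i j).
    rewrite mulr_sumr; apply: eq_bigr => l _.
    by rewrite [row k _ 0 l]mxE [M l j]mxE mulrCA mulrA.
  by rewrite E0 mulr0.
exists (fun i => (\row_j v j *m invmx M) 0 i) => j.
have /matrixP/(_ 0 j) := mulmxKV Mu (\row_j v j); rewrite mxE [RHS]mxE => <-.
by apply: eq_bigr => i _; rewrite [M i j]mxE.
Qed.

End QuotientBases.

(** * The Frobenius product *)

Section Frobenius.
Context {R : realType} (d : nat).
Implicit Types A B C : 'M[R]_d.

Lemma frobC A B : frob A B = frob B A.
Proof. by apply: eq_bigr => i _; apply: eq_bigr => j _; rewrite mulrC. Qed.

Lemma frobDl A B C : frob (A + B) C = frob A C + frob B C.
Proof.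
rewrite /frob -big_split; apply: eq_bigr => i _; rewrite -big_split.
by apply: eq_bigr => j _; rewrite mxE mulrDl.
Qed.

Lemma frobZl (a : R) A B : frob (a *: A) B = a * frob A B.
Proof.
rewrite /frob mulr_sumr; apply: eq_bigr => i _; rewrite mulr_sumr.
by apply: eq_bigr => j _; rewrite mxE mulrA.
Qed.

Lemma frob0l B : frob 0 B = 0.
Proof. by rewrite -[X in frob X B](scale0r 0) frobZl mul0r. Qed.

Lemma frob_suml I (r : seq I) (P : pred I) (F : I -> 'M[R]_d) B :
  frob (\sum_(i <- r | P i) F i) B = \sum_(i <- r | P i) frob (F i) B.
Proof.
elim: r => [|i r IH]; first by rewrite !big_nil frob0l.
by rewrite !big_cons; case: ifP => // _; rewrite frobDl IH.
Qed.

Lemma frob_sumr I (r : seq I) (P : pred I) (F : I -> 'M[R]_d) B :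
  frob B (\sum_(i <- r | P i) F i) = \sum_(i <- r | P i) frob B (F i).
Proof. by rewrite frobC frob_suml; under eq_bigr do rewrite frobC. Qed.

Lemma frobZr (a : R) A B : frob A (a *: B) = a * frob A B.
Proof. by rewrite frobC frobZl frobC. Qed.

Lemma frob_tr A B : frob A^T B^T = frob A B.
Proof.
rewrite /frob exchange_big/=; apply: eq_bigr => i _; apply: eq_bigr => j _.
by rewrite !mxE.
Qed.

Lemma frob_ge0 A : 0 <= frob A A.
Proof. by apply: sumr_ge0 => i _; apply: sumr_ge0 => j _; rewrite -expr2 sqr_ge0. Qed.

Lemma frob_eq0 A : frob A A = 0 -> A = 0.
Proof.
move=> A0; have S0 : \sum_p A p.1 p.2 ^+ 2 = 0.
  by rewrite -[RHS]A0 /frob pair_big/=; apply: eq_bigr => p _; rewrite expr2.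
apply/matrixP => i j; rewrite mxE; apply/eqP; rewrite -sqrf_eq0; apply/eqP.
have sq0 (p : 'I_d * 'I_d) : true -> 0 <= A p.1 p.2 ^+ 2 by rewrite sqr_ge0.
have h := psumr_eq0P sq0 S0. exact: (h (i, j)).
Qed.

Lemma frob_mxvec A B : frob A B = \sum_u mxvec A 0 u * mxvec B 0 u.
Proof.
rewrite /frob pair_big/= [RHS](reindex _ (curry_mxvec_bij d d))/=.
by apply: eq_bigr => -[i j] _ /=; rewrite !mxvecE.
Qed.

Lemma symmx_subspace : subspace_set (@symmx R d).
Proof.
split=> [|a A B /= AT BT]; first by rewrite /symmx /= trmx0.
by rewrite /symmx /= linearD linearZ/= AT BT.
Qed.

(** The set and its mirror image cover all pairs and meet in the diagonal, so twice the cardinality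
    is d^2 + d. *)
Lemma card_upper_pairs :
  #|[set p : 'I_d * 'I_d | (p.1 <= p.2)%N]%SET| = ((d * d.+1)./2)%N.
Proof.
set S := [set _ | _]%SET.
pose S' := [set p : 'I_d * 'I_d | (p.2 <= p.1)%N]%SET.
have SS' : #|S'| = #|S|.
  rewrite -(card_imset S (can_inj (@swap_pairK 'I_d 'I_d))); congr #|pred_of_set _|.
  apply/finset.setP => -[i j]; rewrite !inE/=; apply/idP/imsetP => [ij|[[k l]]].
    by exists (j, i); rewrite ?inE.
  by rewrite inE/= => kl [-> ->].
have U : (S :|: S' = finset.setT)%SET.
  by apply/finset.setP => -[i j]; rewrite !inE/= leq_total.
have I : (S :&: S' = [set (i, i) | i in 'I_d])%SET.
  apply/finset.setP => -[i j]; rewrite !inE/= -eqn_leq.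
  apply/eqP/imsetP => [/val_inj <-|[k _ [-> ->]]//]; by exists i.
have := cardsUI S S'; rewrite U I SS' cardsT card_prod !card_ord card_imset => [|i j []//].
by rewrite card_ord -mulnSr addnn => ->; rewrite doubleK.
Qed.

(** The family has as many members as there are upper entries, so spanning forces independence; a
    right inverse of the matrix of vectorisations then supplies dual tensors. *)
Lemma symmetric_dual_basis (b : 'I_((d * d.+1)./2) -> 'M[R]_d) :
  symmx (d := d) = linspan (range b) ->
  exists bd : 'I_((d * d.+1)./2) -> 'M[R]_d,
    [/\ forall l, symmx (bd l),
        forall l m, frob (b l) (bd m) = (l == m)%:R &
        forall A, symmx A -> A = \sum_l frob A (bd l) *: b l].
Proof.
move=> bspan.
have bsym l : symmx (b l).
  rewrite bspan; exists 1, (fun=> b l), (fun=> 1).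
  by split=> [_|]; [exists l|rewrite big_ord1 scale1r].
pose B : 'M[R]_(_, d * d) := \matrix_l mxvec (b l).
have subB A : symmx A -> (mxvec A <= B)%MS.
  rewrite bspan => -[m [v [c [vb ->]]]]; rewrite linear_sum/= summx_sub// => i _.
  have [l _ <-] := vb i; rewrite linearZ/= scalemx_sub//.
  by rewrite -[mxvec _](rowK (fun l => mxvec (b l))) row_sub.
pose S := [set p : 'I_d * 'I_d | (p.1 <= p.2)%N]%SET.
pose ij (k : 'I_#|S|) := enum_val k.
(* Symmetric unit matrices; the disjunction gives a diagonal pair the entry 1 rather than 2. *)
pose E k : 'M[R]_d := \matrix_(i, j)
  ((((i, j) == ij k) || ((j, i) == ij k))%:R).
pose EM : 'M[R]_(#|S|, d * d) := \matrix_k mxvec (E k).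
have EB : (EM <= B)%MS.
  apply/row_subP => k; rewrite rowK; apply: subB.
  by apply/matrixP => i j; rewrite !mxE orbC.
have Efree : row_free EM.
  apply/row_freeP; exists (\matrix_(u, k) (u == mxvec_index (ij k).1 (ij k).2)%:R).
  apply/matrixP => k k'; rewrite mxE (bigD1 (mxvec_index (ij k').1 (ij k').2))//=.
  rewrite [X in _ * X]mxE eqxx mulr1 big1 ?addr0; last first.
    by move=> u /negbTE uk; rewrite [X in _ * X]mxE uk mulr0.
  rewrite mxE mxvecE !mxE -surjective_pairing; congr (nat_of_bool _)%:R.
  have kS := enum_valP k; have kS' := enum_valP k'.
  rewrite -/(ij k) -/(ij k') !inE in kS kS'.
  have -> : (k == k') = (ij k' == ij k) by rewrite eq_sym (inj_eq enum_val_inj).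
  (* An upper pair that is the swap of another upper pair is diagonal, so the two pairs agree. *)
  case: eqVneq => //= kk'; apply/negbTE; apply: contra_neqN kk' => /eqP e.
  move: kS kS'; rewrite -e /= => h1 h2.
  have e' : (ij k').1 = (ij k').2 by apply/val_inj/eqP; rewrite eqn_leq h1 h2.
  by case: (ij k') e' => i j /= ->.
have Bfree : row_free B.
  rewrite /row_free eqn_leq rank_leq_row/= -{1}card_upper_pairs.
  by rewrite -(eqP Efree) mxrankS.
have [X BX] := row_freeP Bfree.
pose bd0 l : 'M[R]_d := vec_mx (col l X)^T.
have b_bd0 l m : frob (b l) (bd0 m) = (l == m)%:R.
  have /matrixP/(_ l m) := BX; rewrite [RHS]mxE => <-; rewrite mxE frob_mxvec.
  by apply: eq_bigr => u _; rewrite vec_mxK !mxE.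
(* Symmetrising preserves the pairings because every [b l] is symmetric. *)
pose bd l := 2^-1 *: (bd0 l + (bd0 l)^T).
have b_bd l m : frob (b l) (bd m) = (l == m)%:R.
  rewrite /bd frobZr frobC frobDl ![frob _ (b l)]frobC -{2}(bsym l) frob_tr.
  by rewrite b_bd0 -mulr2n -[X in _ * X]mulr_natl mulrA mulVf ?mul1r// pnatr_eq0.
exists bd; split=> //.
  by move=> l; rewrite /symmx /bd /= linearZ/= linearD/= trmxK addrC.
move=> A Asym; have /submxP[c Ac] := subB _ Asym.
have AE : A = \sum_l c 0 l *: b l.
  rewrite -[LHS]mxvecK Ac mulmx_sum_row linear_sum; apply: eq_bigr => l _.
  by rewrite linearZ/= rowK mxvecK.
rewrite {1}AE; apply: eq_bigr => l _; congr (_ *: _).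
rewrite AE frob_suml (bigD1 l)//= frobZl b_bd eqxx mulr1 big1 ?addr0// => m ml.
by rewrite frobZl b_bd (negbTE ml) mulr0.
Qed.

End Frobenius.

(** * Polynomial and square integrable tensor fields *)

Section FunctionSpaces.
Context {R : realType} (d k : nat).

Lemma poly_vec_subspace : subspace_set (@poly_vec R d k).
Proof.
split=> [i|a p q pp qp i].
  rewrite (_ : (fun x => _) = fun=> 0); first exact: poly_fun_cst.
  by apply/funext => x; rewrite mxE.
rewrite (_ : (fun x => _) = fun x => a * p x i 0 + q x i 0).
  by apply: poly_funD; [apply: poly_funZ; exact: pp|exact: qp].
by apply/funext => x; rewrite !mxE.
Qed.

Lemma poly_sym_subspace : subspace_set (@poly_sym R d k).
Proof.
split=> [|a p q [pp psym] [qp qsym]].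
  split=> [i j|x]; last exact: subspace0 (@symmx_subspace R d).
  rewrite (_ : (fun x => _) = fun=> 0); first exact: poly_fun_cst.
  by apply/funext => x; rewrite mxE.
split=> [i j|x]; last by apply: (@symmx_subspace R d).2.
rewrite (_ : (fun x => _) = fun x => a * p x i j + q x i j).
  by apply: poly_funD; [apply: poly_funZ; exact: pp|exact: qp].
by apply/funext => x; rewrite !mxE.
Qed.

Lemma vanish_on_subspace m n (A : set 'cV[R]_d) :
  subspace_set (@vanish_on R d 'M[R]_(m, n) A).
Proof.
split=> [x _ //|a s t s0 t0 x Ax].
by rewrite [LHS]/(a *: s x + t x) s0// t0// scaler0; exact: addr0.
Qed.

Lemma ae_vanish_subspace m n (A : set 'cV[R]_d) :
  subspace_set (@ae_vanish_on R d 'M[R]_(m, n) A).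
Proof.
split=> [|a s t s0 t0]; first exact: ae_onW.
apply: ae_on_impl2 s0 t0 => x _ sx tx.
by rewrite [LHS]/(a *: s x + t x) sx tx scaler0; exact: addr0.
Qed.

Lemma L2_sym_subspace (A : set 'cV[R]_d) : measurable (@tcol R d @^-1` A) ->
  subspace_set (@L2_sym R d A).
Proof.
move=> mA; have s0 : square_integrable_on A (fun _ : 'cV[R]_d => 0 : R).
  split; first exact: measurable_cst.
  by under eq_integral do rewrite expr0n/=; rewrite integral0.
split=> [|a s t [s2 ssym] [t2 tsym]].
  split=> [i j|]; first by under eq_fun do rewrite mxE.
  by apply: ae_onW => x _; exact: subspace0 (@symmx_subspace R d).
split=> [i j|]; last first.
  apply: ae_on_impl2 ssym tsym => x _ sx tx.
  by apply: (@symmx_subspace R d).2.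
rewrite (_ : (fun x => _) = fun x => a * s x i j + t x i j).
  by apply: sqintD => //; exact: sqintZ.
by apply/funext => x; rewrite !mxE.
Qed.

Lemma poly_sym_L2 (A : set 'cV[R]_d) (p : 'cV[R]_d -> 'M[R]_d) :
  measurable (@tcol R d @^-1` A) -> coord_bounded A -> poly_sym k p -> L2_sym A p.
Proof.
move=> mA bA [pp psym]; split; last by apply: ae_onW => x _; exact: psym.
by move=> i j; apply: poly_fun_sqint.
Qed.

Lemma indic_L2 (A B : set 'cV[R]_d) (s : 'cV[R]_d -> 'M[R]_d) :
  measurable (@tcol R d @^-1` A) -> measurable (@tcol R d @^-1` B) ->
  L2_sym A s -> L2_sym A (fun x => \1_B x *: s x).
Proof.
move=> mA mB [s2 ssym]; split; last first.
  by apply: ae_on_impl ssym => x _ sx; exact: subspaceZ (@symmx_subspace R d) _ _ _.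
move=> i j; rewrite (_ : (fun x => _) = fun x => \1_B x * s x i j).
  exact: sqint_indic.
by apply/funext => x; rewrite mxE.
Qed.

Lemma poly_sym_ae_unique (A : set 'cV[R]_d) (p q : 'cV[R]_d -> 'M[R]_d) :
  A° !=set0 -> poly_sym k p -> poly_sym k q -> ae_on A (fun x => p x = q x) -> p = q.
Proof.
move=> A0 [pp _] [qp _] pq; apply/funext => x; apply/matrixP => i j.
apply/eqP; rewrite -subr_eq0; apply/eqP.
have pf : poly_fun k (fun x => p x i j - q x i j).
  under eq_fun do rewrite -mulN1r.
  by apply: poly_funD; [exact: pp|apply: poly_funZ; exact: qp].
apply: (poly_fun_ae0 A0 pf); apply: ae_on_impl pq => y _ ->.
by rewrite subrr.
Qed.

End FunctionSpaces.

(** * The broken polynomial space and the volume pairing *)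

Section Sigma.
Context {R : realType} (d k : nat) (K : star_polytope R d).
Implicit Types (i j : 'I_(nfaces K)) (s t p : 'cV[R]_d -> 'M[R]_d).

Lemma Sigma_L2 s : Sigma_space k K s -> L2_sym (carrier K) s.
Proof. by case. Qed.

Lemma Sigma_subspace : subspace_set (Sigma_space k K).
Proof.
have sL2 := L2_sym_subspace (carrier_measurable K).
split=> [|a s t [s2 sp] [t2 tp]].
  split=> [|i]; first exact: subspace0 sL2.
  by exists 0; [exact: subspace0 (@poly_sym_subspace _ _ _)|exact: ae_onW].
split=> [|i]; first exact: sL2.2.
have [p pp sE] := sp i; have [q qp tE] := tp i.
exists (a *: p + q); first exact: (@poly_sym_subspace _ _ _).2.
by apply: ae_on_impl2 sE tE => x _ sx tx; rewrite [LHS]/(a *: s x + t x) sx tx.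
Qed.

Lemma poly_sym_Sigma p : poly_sym k p -> Sigma_space k K p.
Proof.
move=> pp; split; first exact: poly_sym_L2 (carrier_measurable K) (carrier_bounded K) pp.
by move=> i; exists p => //; exact: ae_onW.
Qed.

Lemma local_polyP i s : Sigma_space k K s ->
  poly_sym k (local_poly k i s) /\ ae_on (pyramid i) (fun x => s x = local_poly k i s x).
Proof.
move=> [_ /(_ i)[p pp sp]].
pose P := [set p | poly_sym k p /\ ae_on (pyramid i) (fun x => s x = p x)].
exact: (@xgetPex _ _ P (ex_intro _ p (conj pp sp))).
Qed.

Lemma local_poly_eq i s p : poly_sym k p ->
  ae_on (pyramid i) (fun x => s x = p x) -> local_poly k i s = p.
Proof.
move=> pp sp.
pose P := [set p | poly_sym k p /\ ae_on (pyramid i) (fun x => s x = p x)].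
have [qp sq] := @xgetPex _ (fun=> 0 : 'M[R]_d) P (ex_intro _ p (conj pp sp)).
apply: (poly_sym_ae_unique (pyramid_interior i) qp pp).
by apply: ae_on_impl2 sq sp => x _ <-.
Qed.

Lemma local_poly_lin i a s t : Sigma_space k K s -> Sigma_space k K t ->
  local_poly k i (a *: s + t) = a *: local_poly k i s + local_poly k i t.
Proof.
move=> sS tS; have [pp sp] := local_polyP i sS; have [qp tq] := local_polyP i tS.
apply: local_poly_eq; first exact: (@poly_sym_subspace _ _ _).2.
by apply: ae_on_impl2 sp tq => x _ sx tx; rewrite [LHS]/(a *: s x + t x) sx tx.
Qed.

Lemma local_poly0 i s : ae_vanish_on (pyramid i) s -> local_poly k i s = 0.
Proof.
by move=> s0; apply: local_poly_eq => //; exact: subspace0 (@poly_sym_subspace _ _ _).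
Qed.

Lemma ae_carrier (P : 'cV[R]_d -> Prop) :
  (forall i, ae_on (@pyramid R d K i) P) -> ae_on (carrier K) P.
Proof. by move=> iP; rewrite carrierE; exact: ae_on_bigcup. Qed.

Lemma ae_pyramid i (P : 'cV[R]_d -> Prop) : ae_on (carrier K) P -> ae_on (pyramid i) P.
Proof. by apply: ae_onS; exact: pyramid_sub. Qed.

Lemma local_poly_sum i (I : finType) (c : I -> R) (e : I -> 'cV[R]_d -> 'M[R]_d) :
  (forall l, Sigma_space k K (e l)) ->
  local_poly k i (\sum_l c l *: e l) = \sum_l c l *: local_poly k i (e l).
Proof.
move=> eS; have E0 : local_poly k i (0 : 'cV[R]_d -> 'M[R]_d) = 0.
  by apply: local_poly0; exact: ae_onW.
suff : forall r : seq I, Sigma_space k K (\sum_(l <- r) c l *: e l) /\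
    local_poly k i (\sum_(l <- r) c l *: e l) = \sum_(l <- r) c l *: local_poly k i (e l).
  by move=> /(_ (index_enum I))[].
elim=> [|l r [rS rE]]; first by rewrite !big_nil; split=> //; exact: subspace0 Sigma_subspace.
rewrite !big_cons; split; first exact: Sigma_subspace.2.
by rewrite local_poly_lin// rE.
Qed.

Definition indic_fun i p : 'cV[R]_d -> 'M[R]_d := fun x => \1_(pyramid i) x *: p x.

(** On another pyramid the indicator is nonzero only on the overlap, which is null; so its values on
    shared lateral faces do not matter. *)
Lemma indic_fun_ae i j p :
  ae_on (pyramid j) (fun x => indic_fun i p x = if i == j then p x else 0).
Proof.
case: eqVneq => [<-|ij].
  by apply: ae_onW => x ix; rewrite /indic_fun indicE mem_set// scale1r.
apply: ae_on_impl (pyramid_overlap _) => [x _ ix|]; last by rewrite eq_sym; exact: ij.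
by rewrite /indic_fun indicE memNset// scale0r.
Qed.

Lemma indic_fun_Sigma i p : poly_sym k p -> Sigma_space k K (indic_fun i p).
Proof.
move=> pp; split.
  apply: indic_L2; [exact: carrier_measurable|exact: pyramid_measurable|].
  exact: poly_sym_L2 (carrier_measurable K) (carrier_bounded K) pp.
move=> j; exists (if i == j then p else 0).
  by case: eqP => // _; exact: subspace0 (@poly_sym_subspace _ _ _).
by apply: ae_on_impl (indic_fun_ae i j p) => x _ ->; case: eqP.
Qed.

Lemma local_poly_indic i j p : poly_sym k p ->
  local_poly k j (indic_fun i p) = if i == j then p else 0.
Proof.
move=> pp; apply: local_poly_eq.
  by case: eqP => // _; exact: subspace0 (@poly_sym_subspace _ _ _).
by apply: ae_on_impl (indic_fun_ae i j p) => x _ ->; case: eqP.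
Qed.

Lemma Sigma_decomp s : Sigma_space k K s ->
  ae_vanish_on (carrier K) (s - \sum_i indic_fun i (local_poly k i s)).
Proof.
move=> sS; apply: ae_carrier => j; have [_ sj] := local_polyP j sS.
have h := ae_on_forall (fun i => indic_fun_ae i j (local_poly k i s)).
apply: ae_on_impl2 sj h => x _ sx hx.
rewrite [LHS]/(s x - (\sum_i indic_fun i (local_poly k i s)) x) fct_sumE.
rewrite (bigD1 j)//= hx eqxx big1 ?addr0 => [|i ij]; first by rewrite sx; exact: subrr.
by rewrite hx (negbTE ij).
Qed.

Lemma volume_integrable s t : L2_sym (carrier K) s -> L2_sym (carrier K) t ->
  (lebesgue_tuple d).-integrable (@tcol R d @^-1` carrier K)
    (EFin \o ((fun x => frob (s x) (t x)) \o @tcol R d)).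
Proof.
move=> [s2 _] [t2 _]; have mK := carrier_measurable K.
rewrite (_ : _ \o _ = fun u => (\sum_i \sum_j (s (tcol u) i j * t (tcol u) i j)%:E)%E).
  apply: integrable_sum => // i _; apply: integrable_sum => // j _.
  exact: sqint_mul_integrable (s2 i j) (t2 i j).
by apply/funext => u /=; rewrite /frob -sumEFin; apply: eq_bigr => i _; rewrite sumEFin.
Qed.

Lemma volume_dofC s t : volume_dof K s t = volume_dof K t s.
Proof. by rewrite /volume_dof; under eq_fun do rewrite frobC. Qed.

Lemma volume_dof_lin a s s' t : L2_sym (carrier K) s -> L2_sym (carrier K) s' ->
  L2_sym (carrier K) t ->
  volume_dof K t (a *: s + s') = a * volume_dof K t s + volume_dof K t s'.
Proof.
move=> s2 s2' t2; have mK := carrier_measurable K.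
have i1 := volume_integrable s2 t2; have i2 := volume_integrable s2' t2.
rewrite /volume_dof /integral_on -RintegralZl// -RintegralD//; last first.
  by apply: eq_integrable (integrableZl mK a i1) => // u _ /=; rewrite EFinM.
by apply: eq_Rintegral => u _ /=; rewrite -frobZl -frobDl.
Qed.

Lemma volume_dof_ae0 s t : L2_sym (carrier K) s -> L2_sym (carrier K) t ->
  ae_vanish_on (carrier K) s -> volume_dof K t s = 0.
Proof.
move=> s2 t2 s0; have mK := carrier_measurable K.
apply: integral_on_ae0 => //.
  by have /measurable_EFinP := measurable_int _ (volume_integrable s2 t2).
by apply: ae_on_impl s0 => x _ ->; rewrite frob0l.
Qed.

Lemma volume_dof_eq0 s : L2_sym (carrier K) s -> volume_dof K s s = 0 ->
  ae_vanish_on (carrier K) s.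
Proof.
move=> s2 s0; have mK := carrier_measurable K.
have := integral_on_ge0_eq0 mK (volume_integrable s2 s2) (fun x _ => frob_ge0 _) s0.
by apply: ae_on_impl => x _; exact: frob_eq0.
Qed.

End Sigma.

(** * Spanning families and liftings from faces *)

Section Spanning.
Context {R : realType} (d k : nat).

Definition monomial_mx m n (e : bmultinom d k.+1 * ('I_m * 'I_n)) (x : 'cV[R]_d) :
  'M[R]_(m, n) := monomial_fun e.1 x *: delta_mx e.2.1 e.2.2.

Lemma poly_mx_span m n (f : 'cV[R]_d -> 'M[R]_(m, n)) :
  (forall i j, poly_fun k (fun x => f x i j)) ->
  exists c, f = \sum_e c e *: @monomial_mx m n e.
Proof.
move=> pf; have /choice[c fE] : forall ij : 'I_m * 'I_n, exists c : bmultinom d k.+1 -> R,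
    (fun x => f x ij.1 ij.2) = fun x => \sum_e c e * monomial_fun e x.
  by move=> [i j]; apply: poly_fun_monomials; exact: pf.
exists (fun e => c e.2 e.1); apply/funext => x; rewrite fct_sumE.
apply/matrixP => i j; rewrite -[LHS]/((fun x => f x (i, j).1 (i, j).2) x) fE.
rewrite summxE -(pair_bigA _ (fun e ij => (c ij e *: monomial_mx (e, ij) x) i j))/=.
apply: eq_bigr => e _; rewrite (bigD1 (i, j))//= big1 ?addr0 => [|[i' j'] /=].
  by rewrite !mxE !eqxx mulr1.
rewrite xpair_eqE !mxE [i == i']eq_sym [j == j']eq_sym => /negbTE ->.
by rewrite !mulr0.
Qed.

Lemma poly_vec_has_dim (A : set 'cV[R]_d) :
  exists m, has_dim_mod (vanish_on A) (@poly_vec R d k) m.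
Proof.
apply: (has_dim_mod_exists (g := @monomial_mx d 1)).
- exact: vanish_on_subspace.
- exact: poly_vec_subspace.
move=> q pq; have [|c qE] := @poly_mx_span d 1 q; first by move=> i j; rewrite (ord1 j); exact: pq.
by exists c; rewrite -qE subrr; exact: subspace0 (vanish_on_subspace _ _ _).
Qed.

Lemma poly_sym_has_dim (A : set 'cV[R]_d) :
  exists m, has_dim_mod (ae_vanish_on A) (@poly_sym R d k) m.
Proof.
apply: (has_dim_mod_exists (g := @monomial_mx d d)).
- exact: ae_vanish_subspace.
- exact: poly_sym_subspace.
move=> p [pp _]; have [c pE] := poly_mx_span pp.
by exists c; rewrite -pE subrr; exact: subspace0 (ae_vanish_subspace _ _ _).
Qed.

(** Monomials times unit matrices, cut off to pyramids, span modulo null functions by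
    [Sigma_decomp]. The off-diagonal ones are not symmetric and lie outside [V], which
    [has_dim_mod_exists] allows. *)
Lemma Sigma_subset_has_dim (K : star_polytope R d) (V : set ('cV[R]_d -> 'M[R]_d)) :
  subspace_set V -> V `<=` Sigma_space k K ->
  exists m, has_dim_mod (ae_vanish_on (carrier K)) V m.
Proof.
move=> sV VS.
apply: (has_dim_mod_exists (g := fun e : 'I_(nfaces K) * (bmultinom d k.+1 * ('I_d * 'I_d)) =>
  indic_fun e.1 (monomial_mx e.2))) => //.
  exact: ae_vanish_subspace.
move=> s /VS sS.
have /choice[c cE] : forall i : 'I_(nfaces K), exists c : bmultinom d k.+1 * ('I_d * 'I_d) -> R,
    local_poly k i s = \sum_e c e *: @monomial_mx d d e.
  by move=> i; apply: poly_mx_span; exact: (local_polyP i sS).1.1.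
exists (fun e => c e.1 e.2); have := Sigma_decomp sS; congr (ae_vanish_on _ (_ - _)).
rewrite -(pair_bigA _ (fun i e => c i e *: indic_fun i (@monomial_mx d d e)))/=.
apply: eq_bigr => i _; rewrite cE; apply/funext => x.
rewrite /indic_fun !fct_sumE scaler_sumr; apply: eq_bigr => e _.
by rewrite [LHS]scalerA mulrC -scalerA.
Qed.

Lemma basis_mod_finType (E : lmodType R) (Z V : set E) (T : finType) (e : T -> E) :
  (forall t, V (e t)) ->
  (forall c : T -> R, Z (\sum_t c t *: e t) -> forall t, c t = 0) ->
  (forall x, V x -> exists c : T -> R, Z (x - \sum_t c t *: e t)) ->
  has_dim_mod Z V #|T|.
Proof.
move=> Ve ie se.
have sumE (F : T -> E) : \sum_(i < #|T|) F (enum_val i) = \sum_t F t.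
  by rewrite -big_enum_val; exact: eq_bigl.
exists (fun i => e (enum_val i)); split=> [i|c Zc i|x Vx]; first exact: Ve.
- rewrite -[i]enum_valK; apply: (ie (fun t => c (enum_rank t))).
  rewrite -sumE; have := Zc; congr Z.
  by apply: eq_bigr => j _; rewrite enum_valK.
- have [c Zc] := se x Vx; exists (fun i => c (enum_val i)).
  by have := Zc; rewrite -sumE.
Qed.

End Spanning.

(** * Symmetric polynomial tensors with prescribed normal trace *)

Section Lifting.
Context {R : realType} (d k : nat) (F : flat_face R d).
Notation n := (face_normal F).

Definition sym_lift (v : 'cV[R]_d) : 'M[R]_d :=
  v *m n^T + n *m v^T - dotv v n *: (n *m n^T).

Lemma mul_tr_dotv (v w : 'cV[R]_d) : v^T *m w = (dotv v w)%:M.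
Proof.
by apply/matrixP => i j; rewrite !ord1 !mxE eqxx; apply: eq_bigr => l _; rewrite mxE.
Qed.

Lemma sym_lift_normal v : sym_lift v *m n = v.
Proof.
rewrite /sym_lift mulmxBl mulmxDl -scalemxAl -!mulmxA !mul_tr_dotv.
by rewrite face_normal_unit mulmx1 mul_mx_scalar mulmx1 addrK.
Qed.

Lemma sym_lift_sym v : symmx (sym_lift v).
Proof.
rewrite /symmx /= /sym_lift linearB linearD linearZ/= !trmx_mul !trmxK.
by rewrite [X in X - _]addrC.
Qed.

(** Orthogonal projection onto the affine hyperplane of [F]; composing with it extends face data
    constantly along the normal. *)
Definition face_proj (x : 'cV[R]_d) : 'cV[R]_d :=
  face_chart F ((face_frame F)^T *m (x - face_origin F)).

Lemma face_proj_id x : face_set F x -> face_proj x = x.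
Proof.
move=> [u _ <-]; rewrite /face_proj /face_chart [_ + _ - _]addrC addKr [_^T *m (_ *m _)]mulmxA.
by rewrite face_frame_orthonormal mul1mx.
Qed.

Definition face_lift (q : 'cV[R]_d -> 'cV[R]_d) : 'cV[R]_d -> 'M[R]_d :=
  fun x => sym_lift (q (face_proj x)).

Lemma face_lift_poly q : poly_vec k q -> poly_sym k (face_lift q).
Proof.
move=> pq; split=> [i j|x]; last exact: sym_lift_sym.
have pqp l : poly_fun k (fun x => q (face_proj x) l 0).
  pose B := face_frame F; pose o := face_origin F.
  rewrite (_ : (fun x => _) = fun x => q ((o - (B *m B^T) *m o) + (B *m B^T) *m x) l 0).
    exact: (@poly_fun_comp_affine _ _ _ _ (fun y => q y l 0)).
  apply/funext => x; congr (q _ _ _).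
  by rewrite /face_proj /face_chart mulmxA mulmxBr addrCA addrC.
rewrite (_ : (fun x => _) = fun x => (n j 0 * q (face_proj x) i 0 + n i 0 * q (face_proj x) j 0) +
    (- (n i 0 * n j 0)) * \sum_l n l 0 * q (face_proj x) l 0).
  apply: poly_funD; first by apply: poly_funD; apply: poly_funZ.
  by apply: poly_funZ; apply: poly_fun_sum => l; apply: poly_funZ.
apply/funext => x; rewrite /face_lift /sym_lift !mxE !big_ord1 !mxE.
rewrite /dotv; under [X in _ = _ + _ * X]eq_bigr do rewrite mulrC.
by rewrite mulNr; congr (_ + _ - _); rewrite mulrC.
Qed.

(** The chart turns [q] into a polynomial in d-1 variables, where the parameter set of the face has
    interior. *)
Lemma poly_vec_face_eq0 q : poly_vec k q ->
  ae_on (face_param F) (fun u => q (face_chart F u) = 0) ->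
  forall u, q (face_chart F u) = 0.
Proof.
move=> pq q0 u; apply/colP => i; rewrite mxE.
have int := polytope_interior (face_param_polytope F).
apply: (poly_fun_ae0 (f := fun u => q (face_chart F u) i 0) (k := k) int).
  exact: (@poly_fun_comp_affine _ _ _ _ (fun y => q y i 0)).
by apply: ae_on_impl q0 => v _ ->; rewrite mxE.
Qed.

End Lifting.

(** * Bubbles and the frame space *)

Section Bubble.
Context {R : realType} (d k : nat) (K : star_polytope R d).
Implicit Types (i j : 'I_(nfaces K)) (s t p : 'cV[R]_d -> 'M[R]_d).

Lemma volume_dof_sumr (I : finType) (c : I -> R) (e : I -> 'cV[R]_d -> 'M[R]_d) t :
  (forall l, L2_sym (carrier K) (e l)) -> L2_sym (carrier K) t ->
  volume_dof K t (\sum_l c l *: e l) = \sum_l c l * volume_dof K t (e l).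
Proof.
move=> e2 t2; have sL2 := L2_sym_subspace (carrier_measurable K).
suff : forall r : seq I, L2_sym (carrier K) (\sum_(l <- r) c l *: e l) /\
    volume_dof K t (\sum_(l <- r) c l *: e l) = \sum_(l <- r) c l * volume_dof K t (e l).
  by move=> /(_ (index_enum I))[].
elim=> [|l r [r2 rE]]; last first.
  by rewrite !big_cons; split; [exact: sL2.2|rewrite volume_dof_lin// rE].
rewrite !big_nil; split; first exact: sL2.1.
by apply: volume_dof_ae0 => //; [exact: sL2.1|exact: ae_onW].
Qed.

Lemma normal_trace_lin i a s t : Sigma_space k K s -> Sigma_space k K t ->
  normal_trace k i (a *: s + t) = a *: normal_trace k i s + normal_trace k i t.
Proof.
move=> sS tS; apply/funext => x; rewrite /normal_trace local_poly_lin//.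
by rewrite [LHS]mulmxDl -scalemxAl.
Qed.

Lemma normal_trace_sum i (I : finType) (c : I -> R) (e : I -> 'cV[R]_d -> 'M[R]_d) :
  (forall l, Sigma_space k K (e l)) ->
  normal_trace k i (\sum_l c l *: e l) = \sum_l c l *: normal_trace k i (e l).
Proof.
move=> eS; apply/funext => x; rewrite /normal_trace local_poly_sum// !fct_sumE.
by rewrite mulmx_suml; apply: eq_bigr => l _; exact: (esym (scalemxAl _ _ _)).
Qed.

Lemma normal_trace_poly i s : Sigma_space k K s -> poly_vec k (normal_trace k i s).
Proof.
move=> sS l; have [[pp _] _] := local_polyP i sS.
rewrite (_ : (fun x => _) = fun x => \sum_m face_normal (face i) m 0 * local_poly k i s x l m).
  by apply: poly_fun_sum => m; apply: poly_funZ; exact: pp.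
by apply/funext => x; rewrite mxE; apply: eq_bigr => m _; rewrite mulrC.
Qed.

Lemma normal_trace_ae0 i s : ae_vanish_on (carrier K) s -> normal_trace k i s = 0.
Proof.
move=> s0; apply/funext => x; rewrite /normal_trace local_poly0 ?mul0mx//.
exact: ae_pyramid.
Qed.

Lemma bubble_subspace : subspace_set (bubble_space k K).
Proof.
split=> [|a s t [sS sn] [tS tn]].
  split; first exact: subspace0 (Sigma_subspace _ _).
  by move=> i x Fx; rewrite normal_trace_ae0//; exact: ae_onW.
split=> [|i]; first exact: (Sigma_subspace _ _).2.
by rewrite normal_trace_lin//; exact: (vanish_on_subspace _ _ _).2.
Qed.

(** The normal trace is itself an admissible test function, so its squared norm integrates to zero
    over the face. *)
Lemma face_dof_eq0 i s : Sigma_space k K s ->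
  (forall q, poly_vec k q -> face_dof k i q s = 0) ->
  vanish_on (face_set (face i)) (normal_trace k i s).
Proof.
move=> sS dof0; have pn := normal_trace_poly i sS.
have cF := polytope_closed (face_param_polytope (face i)).
have mF := closed_measurable_tcol cF.
have bF := polytope_bounded (face_param_polytope (face i)).
pose v u := normal_trace k i s (face_chart (face i) u).
have v2 l : square_integrable_on (face_param (face i)) (fun u => v u l 0).
  apply: (@poly_fun_sqint _ _ _ mF k) => //.
  exact: (@poly_fun_comp_affine _ _ _ _ (fun y => normal_trace k i s y l 0)).
have vi : (lebesgue_tuple d.-1).-integrable (@tcol R d.-1 @^-1` face_param (face i))
    (EFin \o ((fun u => dotv (v u) (v u)) \o @tcol R d.-1)).
  rewrite (_ : _ \o _ = fun u => (\sum_l (v (tcol u) l 0 * v (tcol u) l 0)%:E)%E).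
    by apply: integrable_sum => // l _; exact: (sqint_mul_integrable mF (v2 l) (v2 l)).
  by apply/funext => u /=; rewrite /dotv -sumEFin.
have sq0 (w : 'cV[R]_d) l : true -> 0 <= w l 0 * w l 0 by rewrite -expr2 sqr_ge0.
have v0 : ae_on (face_param (face i)) (fun u => dotv (v u) (v u) = 0).
  apply: (integral_on_ge0_eq0 mF vi _ (dof0 _ pn)) => u _.
  by apply: sumr_ge0 => l; exact: sq0.
move=> _ [u _ <-]; apply: (poly_vec_face_eq0 pn).
apply: ae_on_impl v0 => w _ w0; apply/colP => l; rewrite [RHS]mxE.
by have /eqP := psumr_eq0P (sq0 (v w)) w0 (i := l) isT; rewrite mulf_eq0 orbb => /eqP.
Qed.

Section Frame.
Variables (b : tangential_frame K) (bd : 'I_((d * d.+1)./2) -> 'M[R]_d).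
Hypothesis bd_sym : forall l, symmx (bd l).
Hypothesis bd_dual : forall l m, frob (frame_tensor b l) (bd m) = (l == m)%:R.
Hypothesis bd_span : forall A, symmx A -> A = \sum_l frob A (bd l) *: frame_tensor b l.

Lemma tangent_sym_normal (F : flat_face R d) A : tangent_sym F A -> A *m face_normal F = 0.
Proof.
move=> [m [v [c [vT ->]]]]; rewrite mulmx_suml big1// => l _.
have [x [y [xF yF ->]]] := vT l.
rewrite -!scalemxAl mulmxDl -!mulmxA !mul_tr_dotv xF yF.
by rewrite !mul_mx_scalar !scale0r addr0 !scaler0.
Qed.

Lemma frame_tensor_normal l : frame_tensor b l *m face_normal (face (frame_face b l)) = 0.
Proof.
by apply: tangent_sym_normal; have [+ _ _] := frame_basisP b (frame_face b l); exact.
Qed.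

Lemma frame_tensor_sym l : symmx (frame_tensor b l).
Proof.
have bspan := frame_span b; rewrite bspan.
exists 1, (fun=> frame_tensor b l), (fun=> 1).
by split=> [_|]; [exists l|rewrite big_ord1 scale1r].
Qed.

(** Not an orthogonal projection: each coordinate of [p] in the frame is cut off to the pyramid of
    its own tensor. *)
Definition frame_proj p : 'cV[R]_d -> 'M[R]_d :=
  fun x => \sum_l (\1_(pyramid (frame_face b l)) x * frob (p x) (bd l)) *: frame_tensor b l.

Lemma frame_coeff_poly p l : poly_sym k p -> poly_fun k (fun x => frob (p x) (bd l)).
Proof.
move=> [pp _]; apply: poly_fun_sum => i; apply: poly_fun_sum => j.
by under eq_fun do rewrite mulrC; apply: poly_funZ; exact: pp.
Qed.

Lemma frame_projE p : frame_proj p =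
  \sum_l indic_fun (frame_face b l) (fun x => frob (p x) (bd l) *: frame_tensor b l).
Proof.
apply/funext => x; rewrite fct_sumE; apply: eq_bigr => l _.
by rewrite /indic_fun scalerA.
Qed.

Lemma frame_term_poly p l : poly_sym k p ->
  poly_sym k (fun x => frob (p x) (bd l) *: frame_tensor b l).
Proof.
move=> pp; split=> [i j|x]; last exact: subspaceZ (@symmx_subspace R d) _ _ (frame_tensor_sym l).
rewrite (_ : (fun x => _) = fun x => frame_tensor b l i j * frob (p x) (bd l)).
  exact: poly_funZ (frame_coeff_poly l pp).
by apply/funext => x; rewrite mxE mulrC.
Qed.

(** On its own pyramid the tensor of a term annihilates the base normal; on every other pyramid the
    local polynomial of the term is zero. *)
Lemma frame_proj_bubble p : poly_sym k p -> bubble_space k K (frame_proj p).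
Proof.
move=> pp; rewrite frame_projE; apply: (subspace_sum bubble_subspace) => l _.
split=> [|i x _]; first exact/indic_fun_Sigma/frame_term_poly.
rewrite /normal_trace local_poly_indic; last exact: frame_term_poly.
case: eqP => [<-|_]; last by rewrite mul0mx.
by rewrite -scalemxAl frame_tensor_normal scaler0.
Qed.

Lemma frame_proj_frame p : poly_sym k p -> frame_space k b (frame_proj p).
Proof.
move=> pp; exists (fun l x => frob (p x) (bd l)); split=> // l.
exact: frame_coeff_poly.
Qed.

Lemma frame_space_proj r : frame_space k b r ->
  exists2 p, poly_sym k p & r = frame_proj p.
Proof.
(* The coefficients are polynomials on the whole space, so they assemble into one symmetric
   polynomial, whose dual coordinates give them back. *)
move=> [p [pp ->]]; exists (fun x => \sum_l p l x *: frame_tensor b l).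
  split=> [i j|x]; last first.
    by apply: (subspace_lincomb (@symmx_subspace R d)) => l; exact: frame_tensor_sym.
  rewrite (_ : (fun x => _) = fun x => \sum_l frame_tensor b l i j * p l x).
    by apply: poly_fun_sum => l; exact: poly_funZ.
  by apply/funext => x; rewrite summxE; apply: eq_bigr => l _; rewrite mxE mulrC.
apply/funext => x; apply: eq_bigr => l _; congr (_ * _ *: _).
rewrite frob_suml (bigD1 l)//= frobZl bd_dual eqxx mulr1 big1 ?addr0// => m ml.
by rewrite frobZl bd_dual (negbTE ml) mulr0.
Qed.

Lemma frame_proj_sum (I : finType) (c : I -> R) (e : I -> 'cV[R]_d -> 'M[R]_d) :
  frame_proj (\sum_l c l *: e l) = \sum_l c l *: frame_proj (e l).
Proof.
apply/funext => x; transitivity (\sum_j c j *: frame_proj (e j) x); last by rewrite fct_sumE.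
rewrite /frame_proj; transitivity (\sum_j \sum_l c j *:
  ((\1_(pyramid (frame_face b l)) x * frob (e j x) (bd l)) *: frame_tensor b l)).
  rewrite exchange_big; apply: eq_bigr => l _ /=.
  rewrite fct_sumE frob_suml mulr_sumr scaler_suml; apply: eq_bigr => j _.
  by rewrite [(c j *: e j) x]/(c j *: e j x) frobZl scalerA mulrCA.
by apply: eq_bigr => j _; rewrite scaler_sumr.
Qed.

(* Testing against the dual-basis expansion turns the pairing into the sum of
   squares of the coefficients, although [frame_tensor b] is not orthogonal. *)
Lemma frame_proj_test p : poly_sym k p ->
  (forall t, poly_sym k t -> volume_dof K t (frame_proj p) = 0) ->
  ae_on (carrier K) (fun x => forall l,
    \1_(pyramid (frame_face b l)) x * frob (p x) (bd l) = 0).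
Proof.
move=> pp dof0; pose t x := \sum_l frob (p x) (bd l) *: bd l.
have pt : poly_sym k t.
  split=> [i j|x]; last exact: (subspace_lincomb (@symmx_subspace R d)).
  rewrite (_ : (fun x => _) = fun x => \sum_l bd l i j * frob (p x) (bd l)).
    by apply: poly_fun_sum => l; exact/poly_funZ/frame_coeff_poly.
  by apply/funext => x; rewrite summxE; apply: eq_bigr => l _; rewrite mxE mulrC.
have fE x : frob (frame_proj p x) (t x) =
    \sum_l \1_(pyramid (frame_face b l)) x * frob (p x) (bd l) ^+ 2.
  rewrite frob_suml; apply: eq_bigr => l _; rewrite frobZl frob_sumr.
  rewrite (bigD1 l)//= frobZr bd_dual eqxx mulr1 big1 ?addr0 => [|m ml].
    by rewrite -mulrA expr2.
  by rewrite frobZr bd_dual eq_sym (negbTE ml) mulr0.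
have ge0 x l : true -> 0 <= \1_(pyramid (frame_face b l)) x * frob (p x) (bd l) ^+ 2.
  by move=> _; rewrite mulr_ge0 ?sqr_ge0// indicE.
have s2 := Sigma_L2 (frame_proj_bubble pp).1.
have t2 := Sigma_L2 (poly_sym_Sigma K pt).
have fge0 x : carrier K x -> 0 <= frob (frame_proj p x) (t x).
  by move=> _; rewrite fE; apply: sumr_ge0 => l; exact: ge0.
have f0 := integral_on_ge0_eq0 (carrier_measurable K) (volume_integrable s2 t2) fge0 (dof0 _ pt).
apply: ae_on_impl f0 => x _ /=; rewrite fE => fx0 l.
have /eqP := psumr_eq0P (ge0 x) fx0 (i := l) isT.
by rewrite mulf_eq0 sqrf_eq0 -mulf_eq0 => /eqP.
Qed.

(** Each coefficient vanishes almost everywhere on a pyramid with interior, hence everywhere, and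
    the dual expansion recovers [p]. *)
Lemma frame_proj_eq0 p : poly_sym k p ->
  ae_on (carrier K) (fun x => forall l,
    \1_(pyramid (frame_face b l)) x * frob (p x) (bd l) = 0) ->
  p = 0.
Proof.
move=> pp p0; apply/funext => x; rewrite (bd_span (pp.2 x)) big1// => l _.
rewrite (poly_fun_ae0 (pyramid_interior (frame_face b l)) (frame_coeff_poly l pp)) ?scale0r//.
apply: ae_on_impl (ae_pyramid (frame_face b l) p0) => y ly /(_ l).
by rewrite indicE mem_set// mul1r.
Qed.

Lemma frame_proj_inj p : poly_sym k p -> ae_vanish_on (carrier K) (frame_proj p) -> p = 0.
Proof.
move=> pp p0; apply: frame_proj_eq0 => //; apply: frame_proj_test => // t pt.
have s2 := Sigma_L2 (frame_proj_bubble pp).1.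
exact: volume_dof_ae0 s2 (Sigma_L2 (poly_sym_Sigma K pt)) p0.
Qed.

End Frame.
End Bubble.

(** * Dimension count and unisolvence *)

Section Unisolvence.
Context {R : realType} (d k : nat) (K : star_polytope R d).
Variables (b : tangential_frame K) (bd : 'I_((d * d.+1)./2) -> 'M[R]_d).
Hypothesis bd_sym : forall l, symmx (bd l).
Hypothesis bd_dual : forall l m, frob (frame_tensor b l) (bd m) = (l == m)%:R.
Hypothesis bd_span : forall A, symmx A -> A = \sum_l frob A (bd l) *: frame_tensor b l.
Implicit Types (i : 'I_(nfaces K)) (s t p : 'cV[R]_d -> 'M[R]_d).

Lemma bubble_complement_subspace : subspace_set (bubble_complement k b).
Proof.
have frameL2 r : frame_space k b r -> L2_sym (carrier K) r.
  move=> /(frame_space_proj bd_dual)[p pp ->].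
  exact: Sigma_L2 (frame_proj_bubble b bd pp).1.
split=> [|a s t [sB s0] [tB t0]].
  split=> [|r /frameL2 r2]; first exact: subspace0 (bubble_subspace _ _).
  apply: volume_dof_ae0 => //; last exact: ae_onW.
  exact: subspace0 (L2_sym_subspace (carrier_measurable K)).
split=> [|r rF]; first exact: (bubble_subspace _ _).2.
rewrite volume_dof_lin ?s0 ?t0 ?mulr0 ?addr0//; last exact: frameL2.
  exact: Sigma_L2 sB.1.
exact: Sigma_L2 tB.1.
Qed.

Variables (mP : nat) (eP : 'I_mP -> 'cV[R]_d -> 'M[R]_d).
Hypothesis eP_basis : basis_mod (ae_vanish_on (carrier K)) (@poly_sym R d k) eP.

(** Since [K] has interior, a basis modulo null functions expands polynomials exactly, so the
    expansion can be substituted inside [frame_proj]. *)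
Lemma poly_sym_coord p : poly_sym k p -> exists c : 'I_mP -> R, p = \sum_l c l *: eP l.
Proof.
have [Ve _ se] := eP_basis; move=> pp; have [c pc] := se p pp; exists c.
have intK := polytope_interior (carrier_polytope K).
apply: (poly_sym_ae_unique intK pp).
  exact: subspace_lincomb (@poly_sym_subspace _ _ _) _ _ _ Ve.
by apply: ae_on_impl pc => x _ /eqP; rewrite subr_eq0 => /eqP.
Qed.

(** The Gram matrix of the images of [eP] is definite, since [frame_proj] is injective modulo null
    functions and [eP] is independent; the normal equations then give the orthogonal projection onto
    the frame space. *)
Lemma bubble_projection s : bubble_space k K s ->
  exists c : 'I_mP -> R, bubble_complement k b (s - \sum_l c l *: frame_proj b bd (eP l)).
Proof.
move=> sB; have [Ve ie _] := eP_basis.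
pose f l := frame_proj b bd (eP l).
have fB l : bubble_space k K (f l) by exact: frame_proj_bubble.
have f2 l : L2_sym (carrier K) (f l) by exact: Sigma_L2 (fB l).1.
have s2 : L2_sym (carrier K) s by exact: Sigma_L2 sB.1.
have sumB c : bubble_space k K (\sum_l c l *: f l).
  exact: subspace_lincomb (bubble_subspace _ _) _ _ _ fB.
pose G l m := volume_dof K (f m) (f l).
have [|c cE] := @gram_solve R mP G _ (fun l => volume_dof K (f l) s).
  move=> c c0; apply: ie; pose r := \sum_l c l *: f l.
  have r2 : L2_sym (carrier K) r by exact: Sigma_L2 (sumB c).1.
  have r0 : volume_dof K r r = 0.
    rewrite volume_dof_sumr// -[RHS]c0; apply: eq_bigr => l _.
    rewrite volume_dofC volume_dof_sumr// mulr_sumr; apply: eq_bigr => m _.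
    by rewrite mulrA /G volume_dofC.
  have pp : poly_sym k (\sum_l c l *: eP l).
    exact: subspace_lincomb (@poly_sym_subspace _ _ _) _ _ _ Ve.
  rewrite (frame_proj_inj bd_sym bd_dual bd_span pp); first exact: ae_onW.
  by rewrite frame_proj_sum; exact: volume_dof_eq0 r0.
exists c; split; first exact: subspaceB (bubble_subspace _ _) _ _ sB (sumB c).
(* It is enough to be orthogonal to every [f l]: a member of the frame space is [frame_proj] of a
   polynomial, hence a combination of them. *)
move=> r /(frame_space_proj bd_dual)[p /poly_sym_coord[c' ->] ->].
rewrite frame_proj_sum volume_dofC volume_dof_sumr//; last first.
  exact: subspaceB (L2_sym_subspace (carrier_measurable K)) _ _ s2 (Sigma_L2 (sumB c).1).
rewrite big1// => l _; rewrite volume_dofC addrC -scaleN1r.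
rewrite (volume_dof_lin _ (Sigma_L2 (sumB c).1) s2 (f2 l)).
rewrite (volume_dof_sumr _ f2 (f2 l)).
have -> : \sum_m c m * volume_dof K (f l) (f m) = volume_dof K (f l) s by exact: cE.
by rewrite mulN1r addNr mulr0.
Qed.

Lemma dofs_unisolvent s : Sigma_space k K s ->
  (forall i q, poly_vec k q -> face_dof k i q s = 0) ->
  (forall t, bubble_complement k b t -> volume_dof K t s = 0) ->
  (forall t, poly_sym k t -> volume_dof K t s = 0) ->
  ae_vanish_on (carrier K) s.
Proof.
move=> sS dof1 dof2 dof3; have [Ve _ _] := eP_basis.
have sB : bubble_space k K s by split=> // i; exact: face_dof_eq0 (dof1 i).
have [c tC] := bubble_projection sB; set t := _ - _ in tC.
pose p := \sum_l c l *: eP l.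
have pp : poly_sym k p by exact: subspace_lincomb (@poly_sym_subspace _ _ _) _ _ _ Ve.
have rE : \sum_l c l *: frame_proj b bd (eP l) = frame_proj b bd p.
  by rewrite frame_proj_sum.
have rB := frame_proj_bubble b bd pp.
have t2 : L2_sym (carrier K) t by exact: Sigma_L2 tC.1.1.
have r2 : L2_sym (carrier K) (frame_proj b bd p) by exact: Sigma_L2 rB.1.
have sE : s = 1 *: t + frame_proj b bd p by rewrite scale1r /t rE subrK.
(* [t] is an admissible test function for [s], and its pairing with the frame part vanishes, which
   leaves its squared norm. *)
have t0 : ae_vanish_on (carrier K) t.
  apply: volume_dof_eq0 => //; have := dof2 _ tC; rewrite {1}sE volume_dof_lin// mul1r.
  by rewrite [X in _ + X]volume_dofC (tC.2 _ (frame_proj_frame b bd pp)) addr0.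
have p0 : p = 0.
  apply: (frame_proj_eq0 bd_span pp); apply: (frame_proj_test bd_sym bd_dual pp) => u pu.
  have u2 := Sigma_L2 (poly_sym_Sigma K pu).
  have := dof3 u pu; rewrite sE volume_dof_lin// mul1r.
  by rewrite (volume_dof_ae0 t2 u2 t0) add0r.
rewrite sE p0 scale1r; apply: ae_on_impl t0 => x _ tx.
rewrite [LHS]/(t x + frame_proj b bd 0 x) tx (_ : frame_proj b bd 0 x = 0).
  exact: addr0.
by rewrite /frame_proj big1// => l _; rewrite frob0l mulr0 scale0r.
Qed.

Variables (mF : 'I_(nfaces K) -> nat) (eF : forall i, 'I_(mF i) -> 'cV[R]_d -> 'cV[R]_d).
Hypothesis eF_basis : forall i,
  basis_mod (vanish_on (face_set (face i))) (@poly_vec R d k) (@eF i).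
Variables (mB : nat) (eB : 'I_mB -> 'cV[R]_d -> 'M[R]_d).
Hypothesis eB_basis : basis_mod (ae_vanish_on (carrier K)) (bubble_complement k b) eB.

Definition lifted i (j : 'I_(mF i)) := indic_fun i (face_lift (face i) (eF j)).

Lemma normal_trace_lifted i i' (j : 'I_(mF i')) x : face_set (face i) x ->
  normal_trace k i (lifted j) x = if i' == i then eF j x else 0.
Proof.
move=> Fx; have [Ve _ _] := eF_basis i'.
rewrite /normal_trace local_poly_indic; last exact: face_lift_poly (Ve j).
case: eqP => [ii'|_]; last by rewrite mul0mx.
by case: _ / ii' in Fx *; rewrite /face_lift sym_lift_normal face_proj_id.
Qed.

(** The basis joins face lifts, a basis of the bubble complement and the images of a polynomial
    basis. The normal trace sees only the first kind; orthogonality separates the other two. *)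
Lemma Sigma_has_dim : has_dim_mod (ae_vanish_on (carrier K)) (Sigma_space k K)
  (\sum_(i < nfaces K) mF i + mB + mP)%N.
Proof.
pose T := ({i : 'I_(nfaces K) & 'I_(mF i)} + 'I_mB + 'I_mP)%type.
have -> : (\sum_(i < nfaces K) mF i + mB + mP)%N = #|{: T}|.
  rewrite !card_sum !card_ord card_tagged sumnE big_map big_enum/=.
  by congr (_ + _ + _)%N; apply: eq_bigr => i _; rewrite card_ord.
have [VB iB sB] := eB_basis; have [VP iP sP] := eP_basis.
pose e (u : T) := match u with
  | inl (inl ij) => lifted (tagged ij)
  | inl (inr l) => eB l
  | inr l => frame_proj b bd (eP l)
  end.
have liftS i j : Sigma_space k K (@lifted i j).
  by apply: indic_fun_Sigma; apply: face_lift_poly; have [+ _ _] := eF_basis i; exact.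
have eBS l : Sigma_space k K (eB l) by exact: (VB l).1.1.
have frS l : Sigma_space k K (frame_proj b bd (eP l)).
  exact: (frame_proj_bubble b bd (VP l)).1.
have eS u : Sigma_space k K (e u) by case: u => [[[i j]|l]|l] /=.
have sumE (c : T -> R) : \sum_u c u *: e u =
    \sum_i \sum_(j < mF i) c (inl (inl (Tagged _ j))) *: lifted j +
    \sum_l c (inl (inr l)) *: eB l + \sum_l c (inr l) *: frame_proj b bd (eP l).
  rewrite !big_sumType/= sig_big_dep/=; congr (_ + _ + _).
  by apply: eq_bigr => -[i j].
(* Only lifts from face [i] contribute: other lifts live on other pyramids, and the remaining
   members are bubbles. *)
have traceE (c : T -> R) i x : face_set (face i) x ->
    normal_trace k i (\sum_u c u *: e u) x =
    (\sum_(j < mF i) c (inl (inl (Tagged _ j))) *: eF j) x.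
  move=> Fx; have bubble0 u : bubble_space k K u -> normal_trace k i u x = 0.
    by move=> uB; exact: uB.2.
  rewrite normal_trace_sum// !fct_sumE !big_sumType/=.
  rewrite [X in _ + X]big1 ?addr0 => [|l _]; last first.
    rewrite [LHS]/(c (inr l) *: normal_trace k i (frame_proj b bd (eP l)) x).
    by rewrite (bubble0 _ (frame_proj_bubble b bd (VP l))); exact: scaler0.
  rewrite [X in _ + X]big1 ?addr0 => [|l _]; last first.
    rewrite [LHS]/(c (inl (inr l)) *: normal_trace k i (eB l) x).
    by rewrite (bubble0 _ (VB l).1); exact: scaler0.
  transitivity (\sum_i' \sum_(j < mF i')
      (c (inl (inl (Tagged _ j))) *: normal_trace k i (lifted j)) x).
    by rewrite sig_big_dep/=; apply: eq_bigr => -[i' j].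
  rewrite (bigD1 i)//= [X in _ + X]big1 ?addr0 => [|i' i'i].
    apply: eq_bigr => j _.
    by rewrite [LHS]/(_ *: normal_trace k i (lifted j) x) normal_trace_lifted// eqxx.
  apply: big1 => j _.
  by rewrite [LHS]/(_ *: normal_trace k i (lifted j) x) normal_trace_lifted// (negbTE i'i); exact: scaler0.
apply: (@basis_mod_finType _ _ _ _ T e) => //.
- move=> c c0.
  have cF i (j : 'I_(mF i)) : c (inl (inl (Tagged _ j))) = 0.
    have [_ iF _] := eF_basis i; apply: (iF (fun j => c (inl (inl (Tagged _ j))))).
    by move=> x Fx; rewrite -traceE// normal_trace_ae0.
  move: c0; rewrite sumE big1 ?add0r => [|i _]; last first.
    by rewrite big1// => j _; rewrite cF scale0r.
  set t := \sum_l _ *: eB l; set r := \sum_l _ *: frame_proj _ _ _ => tr0.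
  pose p := \sum_l c (inr l) *: eP l.
  have rE : r = frame_proj b bd p by rewrite frame_proj_sum.
  have pp : poly_sym k p by exact: subspace_lincomb (@poly_sym_subspace _ _ _) _ _ _ VP.
  have tC : bubble_complement k b t.
    exact: subspace_lincomb bubble_complement_subspace _ _ _ VB.
  have t2 := Sigma_L2 tC.1.1; have r2 := Sigma_L2 (frame_proj_bubble b bd pp).1.
  (* [t + r] is null and [t] is orthogonal to [r], so pairing the sum with [r] leaves the squared
     norm of [r]. *)
  have rr0 : volume_dof K r r = 0.
    have := volume_dof_lin 1 t2 r2 r2; rewrite scale1r -rE mul1r => E0.
    have rF : frame_space k b r by rewrite rE; exact: frame_proj_frame.
    rewrite (tC.2 r rF) add0r in E0.
    rewrite -E0; apply: volume_dof_ae0 tr0; last by rewrite rE.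
    by rewrite rE; exact: subspaceD (L2_sym_subspace (carrier_measurable K)) _ _ t2 r2.
  have p0 : p = 0.
    apply: (frame_proj_inj bd_sym bd_dual bd_span pp); rewrite -rE.
    by apply: volume_dof_eq0 rr0; rewrite rE.
  have cP l : c (inr l) = 0.
    by apply: (iP (c \o inr)); rewrite -/p p0; exact: ae_onW.
  have cB l : c (inl (inr l)) = 0.
    apply: (iB (c \o inl \o inr)); rewrite -/t; have := tr0.
    by rewrite /r big1 ?addr0// => m _; rewrite cP scale0r.
  by case=> [[[i j]|l]|l]; [exact: cF|exact: cB|exact: cP].
- move=> s sS.
  (* The lifts match the normal traces only modulo functions vanishing on the faces, which is enough
     for [s - L] to be a bubble. *)
  have exF i : exists cF : 'I_(mF i) -> R,
      vanish_on (face_set (face i)) (normal_trace k i s - \sum_j cF j *: eF j).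
    by have [_ _ sF] := eF_basis i; apply: sF; exact: normal_trace_poly.
  pose cF i := sval (cid (exF i)).
  pose cc (u : T) := if u is inl (inl ij) then cF (tag ij) (tagged ij) else 0.
  pose L := \sum_u cc u *: e u.
  have LE : L = \sum_i \sum_(j < mF i) cF i j *: lifted j.
    rewrite /L sumE [X in _ + X]big1 ?addr0 => [|l _]; last exact: scale0r.
    by rewrite [X in _ + X]big1 ?addr0 => [|l _]; last exact: scale0r.
  have LS : Sigma_space k K L by exact: subspace_lincomb (Sigma_subspace _ _) _ _ _ eS.
  have sB' : bubble_space k K (-1 *: L + s).
    split=> [|i x Fx]; first exact: (Sigma_subspace _ _).2.
    rewrite normal_trace_lin// [LHS]/(-1 *: normal_trace k i L x + normal_trace k i s x).
    rewrite /L traceE// scaleN1r.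
    by apply: etrans (svalP (cid (exF i)) x Fx); exact: addrC.
  have [cP tC] := bubble_projection sB'.
  have [cB cBE] := sB _ tC.
  exists (fun u => match u with
    | inl (inl ij) => cF (tag ij) (tagged ij) | inl (inr l) => cB l | inr l => cP l end).
  have := cBE; congr ae_vanish_on; rewrite sumE/= -LE scaleN1r.
  by rewrite [- L + s]addrC -!addrA !opprD; congr (_ + (_ + _)); exact: addrC.
Qed.

End Unisolvence.

Theorem lemma2p5 (R : realType) (d k : nat) (hd : (2 <= d)%N) (hk : (1 <= k)%N)
    (K : star_polytope R d) (b : tangential_frame K) :
  (exists (mF : 'I_(nfaces K) -> nat) (mB mP : nat),
     [/\ forall i : 'I_(nfaces K),
           has_dim_mod (vanish_on (face_set (face i))) (@poly_vec R d k) (mF i),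
         has_dim_mod (ae_vanish_on (carrier K)) (bubble_complement k b) mB,
         has_dim_mod (ae_vanish_on (carrier K)) (@poly_sym R d k) mP &
         has_dim_mod (ae_vanish_on (carrier K)) (Sigma_space k K)
           (\sum_(i < nfaces K) mF i + mB + mP)%N]) /\
  (forall s : 'cV[R]_d -> 'M[R]_d, Sigma_space k K s ->
     (forall (i : 'I_(nfaces K)) (q : 'cV[R]_d -> 'cV[R]_d),
        poly_vec k q -> face_dof k i q s = 0) ->
     (forall t : 'cV[R]_d -> 'M[R]_d,
        bubble_complement k b t -> volume_dof K t s = 0) ->
     (forall t : 'cV[R]_d -> 'M[R]_d,
        poly_sym k t -> volume_dof K t s = 0) ->
     ae_vanish_on (carrier K) s).
Proof.
have spanb : symmx (d := d) = linspan (range (frame_tensor b)) := frame_span b.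
have [bd [bd_sym bd_dual bd_span]] := symmetric_dual_basis spanb.
(* The polynomial basis is fixed before the split: both halves use it, through the projection onto
   the frame space. *)
have [mP [eP eP_basis]] := @poly_sym_has_dim R d k (carrier K).
split; last exact: (dofs_unisolvent bd_sym bd_dual bd_span eP_basis).
have /choice[mF mF_dim] : forall i : 'I_(nfaces K), exists m,
    has_dim_mod (vanish_on (face_set (face i))) (@poly_vec R d k) m.
  by move=> i; exact: poly_vec_has_dim.
pose eF i := sval (cid (mF_dim i)).
have eF_basis i : basis_mod (vanish_on (face_set (face i))) (@poly_vec R d k) (eF i).
  exact: (svalP (cid (mF_dim i))).
have bubbleS : bubble_complement k b `<=` Sigma_space k K by move=> t [[]].
have sub := @bubble_complement_subspace R d k K b bd bd_dual.
have [mB [eB eB_basis]] := Sigma_subset_has_dim sub bubbleS.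
exists mF, mB, mP; split=> //; [by exists eB|by exists eP|].
exact: (Sigma_has_dim bd_sym bd_dual bd_span eP_basis eF_basis eB_basis).
Qed.
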